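(* Let $p$ be a prime, $q=p^n$ with $n\ge 1$, and let $S\subseteq \mathbb{F}_q$ with $\#S>2$. Then there exists a minimal value set polynomial $F\in\mathbb{F}_q[x]$ with $V_F=S$ if and only if $$S=a\cdot \mathcal{U}^v+b$$ for some $a,b,\mathcal{U},v,k$ such that: (i) $a,b\in\mathbb{F}_q$ with $a\neq 0$; (ii) $k\ge 1$ and $\mathcal{U}$ is an $\mathbb{F}_{p^k}$-subspace of $\mathbb{F}_q$ with $1\in\mathcal{U}$; (iii) $v$ is a positive integer dividing $p^k-1$.
   Context: For $F\in\mathbb{F}_q[x]$, the value set is $V_F=\{F(\alpha):\alpha\in\mathbb{F}_q\}$. A polynomial $F\in\mathbb{F}_q[x]$ of positive degree is a minimal value set polynomial (MVSP) over $\mathbb{F}_q$ if $\#V_F=\lfloor (q-1)/\deg F\rfloor+1$ (equivalently $\#V_F=\lceil q/\deg F\rceil$). For a nonempty subset $\mathcal{U}\subseteq\mathbb{F}_q$ and an integer $v\ge 1$, $\mathcal{U}^v=\{u^v: u\in\mathcal{U}\}$, and $a\cdot\mathcal{U}^v+b=\{a w+b: w\in\mathcal{U}^v\}$. Saying that $\mathcal{U}$ is an $\mathbb{F}_{p^k}$-subspace of $\mathbb{F}_q$ presupposes that $\mathbb{F}_{p^k}$ is a subfield of $\mathbb{F}_q$ (i.e. $k\mid n$). *)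

(* Defs.v *)
From mathcomp Require Import all_boot all_order all_algebra.

Set Implicit Arguments.
Unset Strict Implicit.
Unset Printing Implicit Defensive.

Import GRing.Theory.
Local Open Scope ring_scope.

Definition value_set (F : finFieldType) (f : {poly F}) : {set F} :=
  [set f.[x] | x : F].

(* [(size f).-1] is the degree of [f]; [1 < size f] says that it is positive. *)
Definition is_mvsp (F : finFieldType) (f : {poly F}) : Prop :=
  (1 < size f)%N /\
  #|value_set f| = (((#|F| - 1) %/ (size f).-1) + 1)%N.

Definition is_subfield (F : finFieldType) (K : {set F}) : Prop :=
  divring_closed K.

Definition is_subspace_over (F : finFieldType) (K U : {set F}) : Prop :=
  [/\ 0 \in U,
      {in U &, forall u v, u + v \in U} &
      {in K & U, forall c u, c * u \in U}].

(* [m] plays the role of p^k. A finite field has at most one subfield of a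
   given order, so [K] is "the" field F_m; its existence includes k %| n. *)
Definition is_Fm_subspace (F : finFieldType) (m : nat) (U : {set F}) : Prop :=
  exists K : {set F}, [/\ is_subfield K, #|K| = m & is_subspace_over K U].

Definition power_set_image (F : finFieldType) (U : {set F}) (v : nat) :
  {set F} := [set u ^+ v | u in U].

Definition affine_image (F : finFieldType) (a b : F) (W : {set F}) : {set F} :=
  [set a * w + b | w in W].

(* Main.v *)
(** Write [c] for a value of [f], [fib c] for the product of the [X - x] over the fibre of
    [c], and [f - c = fib c * cof c].  Minimality says that the cofactors have total degree
    less than [deg f], whence [cst c * (fib c)' = - prod_(e != c) cof e] by comparing degrees
    and values.  Eliminating [f'] between these relations for three values shows, again by
    degree, that every cofactor is a p-th power, except possibly that of a single degenerate
    value, all of whose points are multiple.  Translate that value (or any value, if there is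
    none) to [0], and let [L = fib 0] and [T] be the product of the [X - e] over the nonzero
    values [e]; then [L * T(f) = - c * (X^q - X) * L'].  Over an algebraic closure, repeated
    differentiation and extraction of p-th roots turns this identity into the fact that
    [X * T(X^v)] is a p-polynomial, [v] being the multiplicity of [L] in [f].  Its roots form
    a vector space over the field of order [p^k], where [k] is the order of [p] modulo [v],
    and the values are the v-th powers of these roots.  Comparing the Frobenius conjugates of
    [u] and of [u + c] shows that this space lies, up to scaling, in the ground field, unless
    the nonzero values form a coset of a group of roots of unity.

    Conversely, for a subspace [U] let [M] be the product of the [X - u], [u] in [U].  The
    product [N] of the [X - M(x)] over the distinct [M(x)] satisfies [N(M(X)) = X^q - X],
    hence maps the ground field onto [U], and [a * N^v + b] is minimal by counting fibres. *)

Require Import Defs.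
From mathcomp Require Import all_boot all_order all_algebra all_field all_solvable.
From mathcomp Require Import zify ring.

Set Implicit Arguments.
Unset Strict Implicit.
Unset Printing Implicit Defensive.

Import GRing.Theory.
Local Open Scope ring_scope.

Local Notation deg A := (size A%R).-1.

(** * Degrees and p-th roots *)

(* The atoms [size A] reach a goal through several convertible algebraic structures on
   the coefficients, which [lia] would not identify. *)
Ltac abstract_sizes :=
  repeat match goal with H : context [@size _ _] |- _ => revert H end;
  repeat match goal with
  | |- context [@size ?T ?s] => let n := fresh "n" in set n := (@size T s); clearbody n
  end.
Ltac size_lia := abstract_sizes; lia.
Ltac size_nia := abstract_sizes; nia.

Section Degree.
Variable R : idomainType.
Implicit Types A B D : {poly R}.

Lemma degM A B : A != 0 -> B != 0 -> deg (A * B) = (deg A + deg B)%N.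
Proof.
move=> nzA nzB; rewrite size_mul //.
have := nzA; have := nzB; rewrite -!size_poly_gt0; lia.
Qed.

Lemma degM_leq A B : (deg (A * B) <= deg A + deg B)%N.
Proof.
have [->|nzA] := eqVneq A 0; first by rewrite mul0r size_poly0.
have [->|nzB] := eqVneq B 0; first by rewrite mulr0 size_poly0.
by rewrite degM.
Qed.

Lemma degX A k : deg (A ^+ k) = (deg A * k)%N.
Proof.
have [->|nzA] := eqVneq A 0; last by rewrite size_exp.
by case: k => [|k]; rewrite ?expr0 ?size_poly1 ?muln0 // exprS mul0r size_poly0.
Qed.

Lemma degD_leq A B k : (deg A <= k -> deg B <= k -> deg (A + B) <= k)%N.
Proof. by have := size_polyD A B; lia. Qed.

Lemma dvdp_size_eq0 (D A : {poly R}) : D %| A -> (size A < size D)%N -> A = 0.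
Proof.
move=> dvdDA ltAD; apply/eqP; apply: contraTT ltAD => nzA.
by rewrite -leqNgt dvdp_leq.
Qed.

Lemma size_deriv_mul A B : (size (A^`() * B)%R <= deg A + deg B)%N.
Proof.
have [->|nzB] := eqVneq B 0; first by rewrite mulr0 size_poly0.
have [->|nzA'] := eqVneq A^`() 0; first by rewrite mul0r size_poly0.
have nzA : A != 0 by apply: contraNneq nzA' => ->; rewrite linear0.
rewrite size_mul //; have := lt_size_deriv nzA.
by move: nzB nzA'; rewrite -!size_poly_gt0; size_lia.
Qed.

Definition wronskian A B := A * B^`() - A^`() * B.

Lemma size_wronskian A B : (size (wronskian A B) <= deg A + deg B)%N.
Proof.
apply: leq_trans (size_polyD _ _) _.
by rewrite size_polyN geq_max size_deriv_mul mulrC addnC size_deriv_mul.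
Qed.

End Degree.

(** * Frobenius and vanishing derivatives in characteristic p *)

Section CharP.
Variables (p : nat) (K : closedFieldType).
Hypothesis pK : p \in [pchar K].
Implicit Types A B F P : {poly K}.

Let p_gt1 : (1 < p)%N. Proof. exact/prime_gt1/(pcharf_prime pK). Qed.

Lemma pchar_polyC : p \in [pchar {poly K}].
Proof. exact: (rmorph_pchar polyC pK). Qed.

Lemma natr_pchar_neq0 k : (k%:R != 0 :> K) = ~~ (p %| k)%N.
Proof. by rewrite (dvdn_pcharf pK). Qed.

Lemma pth_root (x : K) : exists y, y ^+ p = x.
Proof.
have [|y /rootP] := closed_rootP ('X^p - x%:P) _.
  by rewrite size_XnsubC //; lia.
by rewrite !hornerE => /eqP; rewrite subr_eq0 => /eqP; exists y.
Qed.

Lemma exprp_sum (R : comNzRingType) (I : Type) (r : seq I) (P : pred I) (f : I -> R) :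
  p \in [pchar R] -> (\sum_(i <- r | P i) f i) ^+ p = \sum_(i <- r | P i) f i ^+ p.
Proof. by move=> pR; rewrite -(pFrobenius_autE pR) rmorph_sum. Qed.

Lemma exprpD A B : (A + B) ^+ p = A ^+ p + B ^+ p.
Proof. by rewrite -!(pFrobenius_autE pchar_polyC) rmorphD. Qed.

Lemma exprp_inj : injective (fun A : {poly K} => A ^+ p).
Proof.
move=> A B /= eqAB; apply/eqP; rewrite -subr_eq0.
have: (A - B) ^+ p == 0.
  by rewrite -(pFrobenius_autE pchar_polyC) rmorphB /= !pFrobenius_autE eqAB subrr.
by rewrite expf_eq0 => /andP[].
Qed.

Lemma coef_exprp A k :
  (A ^+ p)`_k = if (p %| k)%N then A`_(k %/ p) ^+ p else 0.
Proof.
have E : A ^+ p = \sum_(i < size A) (A`_i ^+ p) *: 'X^(i * p).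
  rewrite -{1}(coefK A) poly_def exprp_sum ?pchar_polyC //.
  by apply: eq_bigr => i _; rewrite exprZn -exprM.
rewrite E coef_sum; case: ifPn => [/dvdnP[i ->]|ndvd].
  rewrite mulnK ?(ltnW p_gt1) //.
  under eq_bigr => j _ do rewrite coefZ coefXn eqn_pmul2r ?(ltnW p_gt1) //.
  have [ltis|leis] := ltnP i (size A).
    rewrite (bigD1 (Ordinal ltis)) //= eqxx mulr1 big1 ?addr0 // => j.
    by rewrite -val_eqE /= eq_sym => /negPf->; rewrite mulr0.
  rewrite nth_default // expr0n gtn_eqF ?(ltnW p_gt1) // big1 // => j _.
  by rewrite [i == j]gtn_eqF ?mulr0 // (leq_trans (ltn_ord j)).
rewrite big1 // => j _; rewrite coefZ coefXn.
by case: eqP => [e|_]; rewrite ?mulr0 //; rewrite e dvdn_mull in ndvd.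
Qed.

Lemma deriv_exprp A : (A ^+ p)^`() = 0.
Proof. by rewrite deriv_exp (mulrn_pchar pchar_polyC). Qed.

Lemma deriv_exp_dvdp A k : (p %| k)%N -> (A ^+ k)^`() = 0.
Proof. by case/dvdnP=> i ->; rewrite exprM deriv_exprp. Qed.

(** Only exponents divisible by [p] survive, and their coefficients have p-th roots because [K] is
    algebraically closed. *)
Lemma deriv_eq0_exprp A : A^`() = 0 -> exists B, A = B ^+ p.
Proof.
move=> A'0.
have root_of i : exists y, y ^+ p = A`_(i * p) by exact: pth_root.
have [g gE] : exists g : nat -> K, forall i, g i ^+ p = A`_(i * p).
  have ex i : exists y, y ^+ p == A`_(i * p) by have [y <-] := root_of i; exists y.
  by exists (fun i => xchoose (ex i)) => i; exact/eqP/(xchooseP (ex i)).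
exists (\poly_(i < size A) g i); apply/polyP => k; rewrite coef_exprp.
have [/dvdnP[i ->]|ndvd] := ifPn.
  rewrite mulnK ?(ltnW p_gt1) // coef_poly.
  case: ltnP => [_|leis]; first by rewrite gE.
  rewrite expr0n gtn_eqF ?(ltnW p_gt1) // nth_default //.
  by rewrite (leq_trans leis) // leq_pmulr // ltnW.
case: k ndvd => [|k]; first by rewrite dvdn0.
rewrite -natr_pchar_neq0 => nz.
have := congr1 (fun B : {poly K} => B`_k) A'0; rewrite coef_deriv coef0 -mulr_natr.
by move/eqP; rewrite mulf_eq0 (negPf nz) orbF => /eqP.
Qed.

(* [z] is a root of the cofactor of [gcd(P, P')] in [P], but not of its cofactor in [P'];
   an identity between [P] and [P'] composed with [F] is refuted where [F] takes the value [z]. *)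
Lemma deriv_neq0_radical P : P^`() != 0 ->
  exists P1 P2 D, [/\ P = P1 * D, P^`() = P2 * D, D != 0 &
    exists2 z, P1.[z] = 0 & P2.[z] != 0].
Proof.
move=> nzP'.
have nzP : P != 0 by apply: contraNneq nzP' => ->; rewrite linear0.
pose D := gcdp P P^`().
have nzD : D != 0 by rewrite gcdp_eq0 negb_and nzP.
have [P1 EP1] : exists P1, P = P1 * D.
  by exists (P %/ D); rewrite divpK // dvdp_gcdl.
have [P2 EP2] : exists P2, P^`() = P2 * D.
  by exists (P^`() %/ D); rewrite divpK // dvdp_gcdr.
exists P1, P2, D; split => //.
have cop : coprimep P1 P2.
  have: gcdp (P1 * D) (P2 * D) %= 1 * D by rewrite -EP1 -EP2 mul1r eqpxx.
  by rewrite -(eqp_ltrans (mulp_gcdl _ _ _)) eqp_mul2r // -size_poly_eq1.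
have nzP1 : P1 != 0 by apply: contraNneq nzP => h; rewrite EP1 h mul0r.
have P1_gt1 : size P1 != 1%N.
  have: (size D < size P)%N.
    by apply: leq_ltn_trans (lt_size_deriv nzP); rewrite dvdp_leq ?dvdp_gcdr.
  have := size_mul nzP1 nzD; rewrite -EP1 => ->.
  by apply: contraTneq => ->; rewrite add1n ltnn.
have [z /rootP rz] := closed_rootP P1 P1_gt1.
exists z => //; have /(coprimep_root cop) := introT eqP rz; exact.
Qed.

End CharP.

(** * Values with a simple point *)

Section SimplePoints.
Variables (p : nat) (K : closedFieldType).
Hypothesis pK : p \in [pchar K].
Let p_gt1 : (1 < p)%N. Proof. exact/prime_gt1/(pcharf_prime pK). Qed.

(** The power of [X] is a constant for derivation, so it can be eliminated between an identity and
    its derivative. *)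
Lemma deriv_mulXpn m (A : {poly K}) :
  ('X^(p ^ m.+1) * A)^`() = 'X^(p ^ m.+1) * A^`().
Proof. by rewrite derivM (deriv_exp_dvdp pK) ?mul0r ?add0r // expnS dvdn_mulr. Qed.

Lemma deg_root_deriv (F H : {poly K}) a Q :
  F^`() != 0 -> F^`() = a *: H ^+ Q -> (p <= Q)%N -> (p * deg H < deg F)%N.
Proof.
move=> nzF' EF' lepQ.
have nza : a != 0 by apply: contraNneq nzF' => a0; rewrite EF' a0 scale0r.
have: (deg H * Q < deg F)%N.
  have nzF : F != 0 by apply: contraNneq nzF' => ->; rewrite linear0.
  have := lt_size_deriv nzF; have := nzF'; rewrite -size_poly_gt0.
  by rewrite -degX EF' size_scale //; size_lia.
by apply: leq_ltn_trans; rewrite mulnC leq_mul2l lepQ orbT.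
Qed.

Variable F : {poly K}.
Hypothesis F_onto : forall z, exists2 x, F.[x] = z & F^`().[x] != 0.

Let nzF' : F^`() != 0.
Proof. by have [x _] := F_onto 0; apply: contraNneq => ->; rewrite horner0. Qed.

Let F_gt1 : (1 < size F)%N.
Proof.
rewrite ltnNge; apply: contra nzF' => /size1_polyC ->.
by rewrite derivC.
Qed.

(** Differentiating and eliminating the power of [X] gives [H' P(F) = wronskian H Z + H P'(F) F'],
    where the Wronskian has size less than [deg F]. The rest is degree comparison and evaluation at
    simple points. *)
Lemma comp_deriv_const (P Z H : {poly K}) m a Q :
    F^`() = a *: H ^+ Q -> (p <= Q)%N -> (p * deg Z <= deg F)%N ->
    Z + (P \Po F) = 'X^(p ^ m.+1) * H ->
  [/\ (size P^`() <= 1)%N & (2 < size P)%N -> H^`() = 0].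
Proof.
move=> EF' lepQ leZ E.
have leH := deg_root_deriv nzF' EF' lepQ.
have W : H^`() * (P \Po F) = wronskian H Z + H * ((P^`() \Po F) * F^`()).
  have := congr1 deriv E; rewrite deriv_mulXpn. rewrite derivD deriv_comp => E'.
  have: H * (Z^`() + (P^`() \Po F) * F^`()) = H^`() * (Z + (P \Po F)).
    by rewrite E E'; ring.
  by rewrite /wronskian mulrDr [in RHS]mulrDr => /(canLR (addrK _)) <-; ring.
have small : (size (wronskian H Z) < deg F)%N.
  apply: leq_ltn_trans (size_wronskian _ _) _.
  by rewrite -(@ltn_pmul2l p) ?(ltnW p_gt1) // mulnDr; size_nia.
have sizeP' : (size P^`() <= 1)%N.
  (* At a root [w] of [P'], reducing [W] modulo [F - w] gives [H' P(w) = wronskian H Z]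
     exactly, because both sides have degree less than [deg F]. *)
  rewrite leqNgt; apply/negP => P'_gt1.
  have nzP' : P^`() != 0 by rewrite -size_poly_gt0 ltnW.
  have [|w /rootP P'w] := closed_rootP P^`() _; first by rewrite gtn_eqF.
  have Fw_gt1 : size (F - w%:P) = size F.
    by rewrite size_polyDl // size_polyN (leq_ltn_trans (size_polyC_leq1 _)).
  have dvdF G : G.[w] = 0 -> F - w%:P %| G \Po F.
    move/rootP/factor_theorem => [G1 ->].
    by rewrite comp_polyM comp_polyB comp_polyX comp_polyC dvdp_mull.
  have Ew : H^`() * P.[w]%:P = wronskian H Z.
    apply/eqP; rewrite -subr_eq0; apply/eqP/(@dvdp_size_eq0 _ (F - w%:P)).
      have -> : H^`() * P.[w]%:P - wronskian H Z =
          H * ((P^`() \Po F) * F^`()) - H^`() * ((P - P.[w]%:P) \Po F).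
        by rewrite comp_polyB comp_polyC mulrBr W; ring.
      apply: dvdp_sub; apply: dvdp_mull; last by rewrite dvdF // !hornerE subrr.
      by apply: dvdp_mulr; apply: dvdF.
    rewrite Fw_gt1; apply: leq_ltn_trans (size_polyD _ _) _.
    rewrite size_polyN gtn_max (leq_trans small) ?leq_pred // andbT mulrC mul_polyC.
    apply: leq_ltn_trans (size_scale_leq _ _) _.
    have [->|nzH] := eqVneq H 0; first by rewrite linear0 size_poly0 ltnW.
    apply: ltn_trans (lt_size_deriv nzH) _; have := F_gt1; size_nia.
  (* [P - P(w)] has the derivative of [P], so [W] and [Ew] relate the two through [F]. Above the
     value [z] there is a point with [F' != 0], where this relation forces [H], hence [F' = a H^Q],
     to vanish. *)
  have [P1 [P2 [D [EP EP' nzD [z P1z P2z]]]]] : exists P1 P2 D, [/\ P - P.[w]%:P = P1 * D,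
     P^`() = P2 * D, D != 0 & exists2 z, P1.[z] = 0 & P2.[z] != 0].
    have -> : P^`() = (P - P.[w]%:P)^`() by rewrite derivB derivC subr0.
    by apply: deriv_neq0_radical; rewrite derivB derivC subr0.
  have: H^`() * (P1 \Po F) = H * ((P2 \Po F) * F^`()).
    apply: (@mulIf _ (D \Po F)); first by rewrite comp_poly_eq0.
    rewrite -[LHS]mulrA -comp_polyM -EP comp_polyB comp_polyC mulrBr Ew W EP' comp_polyM.
    by ring.
  have [x Fx F'x] := F_onto z.
  move/(congr1 (fun A : {poly K} => A.[x])); rewrite !hornerM !horner_comp Fx P1z mulr0.
  move/esym/eqP; rewrite !mulf_eq0 (negPf P2z) (negPf F'x) !orbF => /eqP Hx.
  move: F'x; rewrite EF' hornerZ horner_exp Hx expr0n.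
  by rewrite gtn_eqF ?mulr0 ?eqxx // (leq_trans _ lepQ) // ltnW.
split=> // P_gt2.
have [c EP'] : exists c, P^`() = c%:P by exists P^`()`_0; apply: size1_polyC.
apply/eqP; apply: contraTT isT => nzH'.
have nzP : P != 0 by rewrite -size_poly_gt0; size_lia.
have sPF : deg (P \Po F) = (deg P * deg F)%N by exact: size_comp_poly.
have nzPF : P \Po F != 0 by rewrite comp_poly_eq0.
(* As [P'] is constant, [W] bounds this degree by [deg H + deg F], which is less than [2 deg F],
   while [P \Po F] alone has degree at least [2 deg F]. *)
have : (deg (H^`() * (P \Po F)) <= deg H + deg F)%N.
  rewrite W; apply: degD_leq; first by have := small; size_lia.
  apply: leq_trans (degM_leq _ _) _; rewrite EP' comp_polyC mul_polyC leq_add2l.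
  have := size_scale_leq c F^`(); have := lt_size_deriv (_ : F != 0).
  rewrite -size_poly_gt0 => /(_ (ltnW F_gt1)); size_lia.
rewrite degM // sPF; move: leH P_gt2 F_gt1. 
by move: (deg H^`()) p_gt1; size_nia.
Qed.

(* Each step removes the linear term of [P] and takes a p-th root, lowering [m] by one. *)
Lemma comp_exponents m : forall (P Z H : {poly K}) a Q,
    F^`() = a *: H ^+ Q -> (p <= Q)%N -> (p * deg Z <= deg F)%N ->
    Z + (P \Po F) = 'X^(p ^ m) * H ->
  forall k, P`_k != 0 -> k = 0%N \/ exists i, k = (p ^ i)%N.
Proof.
have low_deg (P : {poly K}) k : (size P <= 2)%N -> P`_k != 0 ->
    k = 0%N \/ exists i, k = (p ^ i)%N.
  move=> P_le2 Pk; have : (k < 2)%N.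
    by apply: leq_trans P_le2; rewrite ltnNge; apply: contra Pk => /leq_sizeP->.
  by case: k {Pk} => [|[|k]] // _; [left | right; exists 0%N].
have nzF : F != 0 by rewrite -size_poly_gt0 ltnW.
elim: m => [|m IHm] P Z H a Q EF' lepQ leZ E k Pk.
  (* For [m = 0] the right side [X H] has degree at most [deg F], so [P] is at most linear. *)
  apply: low_deg Pk; rewrite leqNgt; apply/negP => P_gt2.
  have leH := deg_root_deriv nzF' EF' lepQ.
  have sPF : deg (P \Po F) = (deg P * deg F)%N by exact: size_comp_poly.
  have : (deg (P \Po F) <= deg F)%N.
    have -> : (P \Po F) = 'X * H - Z by rewrite -E addrC addKr.
    apply: degD_leq; last by rewrite size_polyN; move: p_gt1 leZ; size_nia.
    apply: leq_trans (degM_leq _ _) _; rewrite size_polyX; move: p_gt1 leH; size_nia.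
  by rewrite sPF; move: P_gt2 F_gt1; size_nia.
have [P'_le1 H'0] := comp_deriv_const EF' lepQ leZ E.
have [P_le2|P_gt2] := leqP (size P) 2; first exact: low_deg Pk.
move/(_ P_gt2): H'0 => H'0.
have EP' := size1_polyC P'_le1; set c := P^`()`_0 in EP'.
have [P1 EP1] : exists P1, P - c *: 'X = P1 ^+ p.
  by apply: deriv_eq0_exprp; rewrite // derivB derivZ derivX EP' alg_polyC subrr.
have [H1 EH1] := deriv_eq0_exprp pK H'0.
have [Z1 EZ1] : exists Z1, Z + c *: F = Z1 ^+ p.
  apply: (deriv_eq0_exprp pK); rewrite derivD derivZ.
  have := congr1 deriv E; rewrite deriv_mulXpn H'0 mulr0 derivD deriv_comp EP'.
  by rewrite comp_polyC mul_polyC.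
have E1 : Z1 + (P1 \Po F) = 'X^(p ^ m) * H1.
  apply: (exprp_inj pK); rewrite /= exprMn -exprM -expnSr -EH1 -E.
  rewrite (exprpD pK) -EZ1 -[X in _ + X](rmorphXn (comp_poly F)) /= -EP1.
  by rewrite comp_polyB comp_polyZ comp_polyX; ring.
have leZ1 : (p * deg Z1 <= deg F)%N.
  rewrite mulnC -degX -EZ1; apply: degD_leq; first by move: p_gt1 leZ; size_nia.
  by have := size_scale_leq c F; size_lia.
(* [Q] absorbs the factor [p] lost in passing from [H] to its root. *)
have EF1 : F^`() = a *: H1 ^+ (p * Q) by rewrite exprM -EH1.
have lepQ1 : (p <= p * Q)%N by rewrite leq_pmulr // (leq_trans _ lepQ) // ltnW.
have [k0|[i ki]] : k = 1%N \/ exists2 j, k = (p * j)%N & P1`_j != 0.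
- have: (c *: 'X + P1 ^+ p)`_k != 0 by rewrite -EP1 addrC subrK.
  rewrite coefD coefZ coefX (coef_exprp pK); have [->|_] := eqVneq k 1%N; first by left.
  rewrite mulr0 add0r; case: ifP => // [/dvdnP[j ->]|_]; last by rewrite eqxx.
  rewrite mulnK ?(ltnW p_gt1) // expf_eq0 negb_and => /orP[|nz]; first by rewrite (ltnW p_gt1).
  by right; exists j; rewrite // mulnC.
- by right; exists 0%N.
move=> /(IHm _ _ _ _ _ EF1 lepQ1 leZ1 E1) [i0|[l il]]; [left | right].
  by rewrite ki i0 muln0.
by exists l.+1; rewrite ki il expnS.
Qed.

End SimplePoints.

(** * A value with only multiple points *)

Section MultiplePoints.
Variables (p : nat) (K : closedFieldType).
Hypothesis pK : p \in [pchar K].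
Let p_gt1 : (1 < p)%N. Proof. exact/prime_gt1/(pcharf_prime pK). Qed.

Variables (F L : {poly K}) (v : nat) (x0 : K).
Hypotheses (v_gt1 : (1 < v)%N) (p_ndvd_v : ~~ (p %| v)%N) (Lx0 : L.[x0] = 0).
Hypothesis F_deriv_coprime : forall x, L^`().[x] = 0 -> F.[x] != 0.
Hypothesis F_onto : forall z, z != 0 -> exists2 x, F.[x] = z & L^`().[x] != 0.

Section Step.
Variables (Z N H R : {poly K}) (a : K) (Q b j : nat).
Hypotheses (Q_gt0 : (0 < Q)%N) (p_dvd_Q : (p %| Q)%N).
Hypotheses (EF : F = L ^+ v * N ^+ Q) (Nx0 : N.[x0] != 0).
Hypotheses (EL' : L^`() = a *: H ^+ Q) (vj : (1 + v * j = Q * b)%N) (R0 : R.[0] != 0).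

Let Fx0 : F.[x0] = 0.
Proof. by rewrite EF hornerM horner_exp Lx0 expr0n gtn_eqF ?mul0r // ltnW. Qed.

Let L'x0 : L^`().[x0] != 0.
Proof. by apply/negP => /eqP/F_deriv_coprime; rewrite Fx0 eqxx. Qed.

Let root_H x : H.[x] = 0 -> L^`().[x] = 0.
Proof.
by move=> Hx; rewrite EL' hornerZ horner_exp Hx expr0n gtn_eqF // mulr0.
Qed.

Let b_gt0 : (0 < b)%N. Proof. by case: b vj => //; rewrite muln0. Qed.
Let p_ndvd_j : ~~ (p %| j)%N.
Proof.
apply/negP => pj; have: (p %| 1 + v * j)%N by rewrite vj dvdn_mulr.
by rewrite dvdn_addl ?dvdn_mull // dvdn1 gtn_eqF.
Qed.
Let j_gt0 : (0 < j)%N. Proof. by case: j p_ndvd_j; rewrite ?dvdn0. Qed.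

Let F_gt1 : (1 < size F)%N.
Proof.
rewrite ltnNge; apply/negP => /size1_polyC EFc.
have [x Fx _] := F_onto (oner_neq0 K).
by have /eqP := Fx; rewrite EFc hornerC -(hornerC F`_0 x0) -EFc Fx0 eq_sym oner_eq0.
Qed.

(** By [vj], [L ^+ b * N ^+ j] is a [Q]-th root of [L * F ^+ j]. Once the Wronskian of [H] and [Z]
    vanishes, [R' = 0] follows by evaluating above a nonzero root, [p %| b] by evaluating at [x0],
    and [H' = 0] by coprimality of [H] and [N]; then [N' = 0] because [p] does not divide [j], and
    [Z' = 0] from the Wronskian. *)
Lemma wronskian_step m :
    (deg Z + deg H <= deg L * b.-1 + deg N * j.-1)%N ->
    Z + L ^+ b * N ^+ j * (R \Po F) = 'X^(p ^ m.+1) * H ->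
  [/\ R^`() = 0, H^`() = 0, (p %| b)%N, N^`() = 0 & Z^`() = 0].
Proof.
move=> le_ZH E.
have nzH : H != 0 by apply: contraNneq L'x0 => H0; rewrite root_H // H0 horner0.
have nzN : N != 0 by apply: contraNneq Nx0 => ->; rewrite horner0.
have nzL : L != 0 by apply: contraNneq L'x0 => ->; rewrite linear0 horner0.
have nzR : R != 0 by apply: contraNneq R0 => ->; rewrite horner0.
have EF' : F^`() = (v%:R * L ^+ v.-1 * N ^+ Q) * L^`().
  rewrite {1}EF derivM (deriv_exp_dvdp pK N p_dvd_Q) mulr0 addr0 deriv_exp.
  by ring.
have Eb := prednK b_gt0; have Ej := prednK j_gt0.
set b0 := b.-1 in Eb le_ZH; set j0 := j.-1 in Ej le_ZH; clearbody b0 j0.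
pose C := L ^+ b0 * N ^+ j0.
have nzC : C != 0 by rewrite mulf_neq0 // expf_neq0.
pose G := R \Po F; pose G' := (R^`() \Po F) * F^`().
pose A1 := b%:R * L^`() * N * G + j%:R * L * N^`() * G + L * N * G'.
have EA : L ^+ b * N ^+ j * G = C * (L * N * G).
  by rewrite -Eb -Ej !exprS /C; ring.
have EA' : (L ^+ b * N ^+ j * G)^`() = C * A1.
  rewrite !derivM !deriv_exp deriv_comp -/G' /A1 /C -Eb -Ej /= !exprS.
  by ring.
have W : wronskian H Z = C * (H^`() * (L * N * G) - H * A1).
  have := congr1 deriv E; rewrite (deriv_mulXpn pK) derivD EA' EA in E * => E'.
  have: H * (Z^`() + C * A1) = H^`() * (Z + C * (L * N * G)).
    by rewrite E E'; ring.
  move=> h; rewrite /wronskian; apply/eqP; rewrite -subr_eq0.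
  by apply/eqP; move/eqP: h; rewrite -subr_eq0 => /eqP <-; ring.
(* [W] makes [C] divide a Wronskian whose degree is less than that of [C]. *)
have W0 : wronskian H Z = 0.
  apply: (@dvdp_size_eq0 _ C); first by rewrite W dvdp_mulr.
  apply: leq_ltn_trans (size_wronskian _ _) _.
  have dC : deg C = (deg L * b0 + deg N * j0)%N.
    by rewrite degM ?expf_neq0 // !degX.
  by rewrite addnC (leq_ltn_trans le_ZH) // -dC prednK // size_poly_gt0.
have EG : H^`() * (L * N * G) = H * A1.
  move/eqP: W0; rewrite W mulf_eq0 (negPf nzC) /= subr_eq0 => /eqP; exact.
have R'0 : R^`() = 0.
  apply/eqP; apply: contraTT isT => nzR'.
  have [R1 [R2 [D [ER ER' nzD [z R1z R2z]]]]] := deriv_neq0_radical nzR'.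
  (* [F_onto] reaches only nonzero values; this is where [R.[0] != 0] is needed. *)
  have nzz : z != 0.
    by apply: contraNneq R0 => z0; rewrite z0 in R1z; rewrite ER hornerM R1z mul0r.
  have [x Fx L'x] := F_onto nzz.
  have := Fx; rewrite EF hornerM => LNx.
  have Lx : L.[x] != 0.
    by apply: contraNneq nzz => Lx; rewrite -LNx horner_exp Lx expr0n gtn_eqF ?mul0r // ltnW.
  have Nx : N.[x] != 0.
    by apply: contraNneq nzz => Nx; rewrite -LNx !horner_exp Nx expr0n gtn_eqF ?mulr0.
  have nzDF : D \Po F != 0 by rewrite comp_poly_eq0.
  have EGD : H^`() * (L * N * (R1 \Po F)) =
      H * ((b%:R * L^`() * N + j%:R * L * N^`()) * (R1 \Po F)
                + L * N * ((R2 \Po F) * F^`())).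
    apply: (mulIf nzDF); move: EG; rewrite /A1 /G /G' ER' ER !comp_polyM => EG.
    rewrite -[LHS](_ : H^`() * (L * N * ((R1 \Po F) * (D \Po F))) = _); last by ring.
    by rewrite EG; ring.
  have := congr1 (fun A : {poly K} => A.[x]) EGD.
  rewrite /= !(hornerM, hornerD) !horner_comp Fx R1z !mulr0 add0r => /esym/eqP.
  rewrite EF' !hornerM !horner_exp !mulf_eq0 (negPf Lx) (negPf Nx) (negPf R2z) (negPf L'x).
  rewrite !expf_eq0 (negPf Lx) (negPf Nx) !andbF !orbF /=.
  rewrite -polyC_natr hornerC => /orP[/eqP/root_H L'x0'|]; first by rewrite L'x0' eqxx in L'x.
  by rewrite (negPf (_ : v%:R != 0)) // (natr_pchar_neq0 pK).
have nzG : G != 0 by rewrite comp_poly_eq0.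
have EH : H^`() * (L * N) = H * (b%:R * L^`() * N + j%:R * L * N^`()).
  apply: (mulIf nzG); have := EG; rewrite /A1 /G' R'0 comp_poly0 mul0r mulr0 addr0.
  by move=> e; rewrite -[LHS]mulrA e; ring.
have Hx0 : H.[x0] != 0 by apply: contra L'x0 => /eqP/root_H->.
(* At [x0] the polynomial [L] vanishes and [H], [N], [L'] do not, which isolates the coefficient
   [b]. *)
have pb : (p %| b)%N.
  have := congr1 (fun A : {poly K} => A.[x0]) EH.
  rewrite /= !(hornerM, hornerD) Lx0 mul0r !mulr0 mul0r addr0 => /esym/eqP.
  rewrite !mulf_eq0 (negPf Hx0) (negPf Nx0) (negPf L'x0) !orbF /= -polyC_natr hornerC.
  by rewrite (dvdn_pcharf pK).
have EN : H^`() * N = H * (j%:R * N^`()).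
  apply: (mulfI nzL); have := EH.
  have -> : b%:R = 0 :> {poly K}.
    by apply/eqP; rewrite -(dvdn_pcharf (pchar_polyC pK)).
  by rewrite !mul0r add0r => e; rewrite mulrCA e; ring.
have cop : coprimep H N.
  apply: Pdiv.ClosedField.root_coprimep => x /rootP/root_H/F_deriv_coprime.
  apply: contra => /eqP Nx; rewrite EF hornerM !horner_exp Nx expr0n gtn_eqF //.
  by rewrite mulr0.
have H'0 : H^`() = 0.
  have: H %| H^`() by rewrite -(Gauss_dvdpl _ cop) EN dvdp_mulr.
  by move/dvdp_size_eq0; apply; exact: lt_size_deriv.
have N'0 : N^`() = 0.
  apply/eqP; move/eqP: EN; rewrite H'0 mul0r eq_sym mulf_eq0 (negPf nzH) mulf_eq0 /=.
  by rewrite -polyC_natr polyC_eq0 (negPf (_ : j%:R != 0)) // (natr_pchar_neq0 pK).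
have Z'0 : Z^`() = 0.
  apply/eqP; move/eqP: W0; rewrite /wronskian H'0 mul0r subr0 mulf_eq0.
  by rewrite (negPf nzH).
by split.
Qed.
End Step.

(* When [b = 1] the constant term of [R] contributes the exponent [p ^ 0] and is moved into
   [Z]; the remaining terms are then p-th powers and a p-th root lowers [m] by one. *)
Lemma comp_exponents_mul m : forall (Z N H R : {poly K}) a Q b j,
    (0 < Q)%N -> (p %| Q)%N -> F = L ^+ v * N ^+ Q -> N.[x0] != 0 ->
    L^`() = a *: H ^+ Q -> (1 + v * j = Q * b)%N -> R.[0] != 0 ->
    (p * deg Z <= deg L + p * (deg N * j.-1))%N ->
    Z + L ^+ b * N ^+ j * (R \Po F) = 'X^(p ^ m) * H ->
  forall k, R`_k != 0 -> exists i, (b + v * k = p ^ i)%N.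
Proof.
have Fx0 Q N : F = L ^+ v * N ^+ Q -> F.[x0] = 0.
  by move->; rewrite hornerM horner_exp Lx0 expr0n gtn_eqF ?mul0r // ltnW.
have L'x0 Q N : F = L ^+ v * N ^+ Q -> L^`().[x0] != 0.
  by move=> EF; apply/negP => /eqP/F_deriv_coprime; rewrite (Fx0 Q N) ?eqxx.
have const_R (R : {poly K}) k : (size R <= 1)%N -> R`_k != 0 -> k = 0%N.
  by move=> R_le1; case: k => // k; rewrite nth_default ?eqxx // (leq_trans R_le1).
elim: m => [|m IHm] Z N H R a Q b j Q_gt0 p_dvd_Q EF Nx0 EL' vj R0 leZ E k Rk.
all: have nzL' : L^`() != 0 by apply: contraNneq (L'x0 Q N EF) => ->; rewrite horner0.
all: have nzL : L != 0 by apply: contraNneq nzL' => ->; rewrite linear0.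
all: have nzN : N != 0 by apply: contraNneq Nx0 => ->; rewrite horner0.
all: have nzR : R != 0 by apply: contraNneq R0 => ->; rewrite horner0.
all: have b_gt0 : (0 < b)%N by case: (b) vj => //; rewrite muln0.
all: have leH := deg_root_deriv pK nzL' EL' (dvdn_leq Q_gt0 p_dvd_Q).
all: have j_gt0 : (0 < j)%N by rewrite lt0n; apply: contraTneq p_dvd_Q => j0;
  have: (Q %| 1)%N; [by apply/dvdnP; exists b; rewrite mulnC -vj j0 muln0 |];
  by rewrite dvdn1 => /eqP->; rewrite dvdn1 gtn_eqF.
- have F_gt1 : (1 < size F)%N.
    rewrite ltnNge; apply/negP => /size1_polyC EFc.
    have [x Fx _] := F_onto (oner_neq0 K).
    by have /eqP := Fx; rewrite EFc hornerC -(hornerC F`_0 x0) -EFc (Fx0 Q N) // eq_sym oner_eq0.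
  have nzG : R \Po F != 0 by rewrite comp_poly_eq0.
  have sG : deg (R \Po F) = (deg R * deg F)%N by exact: size_comp_poly.
  have nzF : F != 0 by rewrite -size_poly_gt0 ltnW.
  have dF : deg F = (deg L * v + deg N * Q)%N by rewrite {1}EF degM ?expf_neq0 // !degX.
  (* In the base case [X H] has degree at most [deg L], which leaves room only for [b = 1] and a
     constant [R]: the exponent is [p ^ 0]. *)
  have : (deg L * b + deg N * j + deg R * deg F <= maxn (deg L) (deg Z))%N.
    rewrite -sG -!degX -!degM ?mulf_neq0 ?expf_neq0 //.
    have -> : L ^+ b * N ^+ j * (R \Po F) = 'X * H - Z by rewrite -E addrC addKr.
    apply: degD_leq; last by rewrite size_polyN leq_maxr.
    apply: leq_trans (degM_leq _ _) _; rewrite size_polyX leq_max; apply/orP; left.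
    by rewrite add1n (leq_ltn_trans _ leH) // leq_pmull // ltnW.
  move=> le_max.
  have [b1 dR0] : b = 1%N /\ deg R = 0%N.
    have leZ' : (deg Z <= deg L + deg N * j)%N.
      rewrite -(@leq_pmul2l p) ?(ltnW p_gt1) // (leq_trans leZ) // mulnDr.
      by rewrite leq_add ?leq_pmull ?leq_mul ?leq_pred // ltnW.
    have : (deg L * b + deg R * deg F <= deg L)%N.
      rewrite -(@leq_add2r (deg N * j)) addnAC (leq_trans le_max) //.
      by rewrite geq_max leq_addr.
    have leLF : (deg L <= deg F)%N by rewrite dF -[leqLHS]addn0 leq_add ?leq_pmulr // ltnW.
    have : (0 < deg L)%N by rewrite (leq_trans _ leH).
    move: leLF b_gt0; clear; move: (deg L) (deg F) (deg R) => l f r.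
    case: b r => [|[|b]] [|r] //; rewrite ?muln1 ?mulnS ?mulSn; lia.
  have k0 : k = 0%N by apply: const_R Rk; rewrite -ltnS; case: (size R) dR0 => // ? /= ->.
  by exists 0%N; rewrite b1 k0 muln0.
(* The descent is stated for fresh data: it serves the given identity when [1 < b], and the one
   obtained by splitting off [R.[0]] when [b = 1]. *)
have core (Z1 R1 : {poly K}) b1 j1 k1 :
    (1 + v * j1 = Q * b1)%N -> R1.[0] != 0 ->
    (deg Z1 <= deg L + deg N * j1.-1)%N ->
    (deg Z1 + deg H <= deg L * b1.-1 + deg N * j1.-1)%N ->
    Z1 + L ^+ b1 * N ^+ j1 * (R1 \Po F) = 'X^(p ^ m.+1) * H ->
    R1`_k1 != 0 -> exists i, (b1 + v * k1 = p ^ i)%N.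
  move=> vj1 R10 leZ1 leZH E1 R1k.
  have [R'0 H'0 /dvdnP[b2 Eb] N'0 Z'0] :=
    wronskian_step Q_gt0 p_dvd_Q EF Nx0 EL' vj1 R10 leZH E1.
  have [R2 ER] := deriv_eq0_exprp pK R'0; have [H2 EH] := deriv_eq0_exprp pK H'0.
  have [N2 EN] := deriv_eq0_exprp pK N'0; have [Z2 EZ] := deriv_eq0_exprp pK Z'0.
  move: R1k; rewrite ER (coef_exprp pK); case: ifP; last by rewrite eqxx.
  move=> /dvdnP[k2 Ek]; rewrite Ek mulnK ?(ltnW p_gt1) // expf_eq0 negb_and.
  case/orP=> [|R2k]; first by rewrite (ltnW p_gt1).
  have E2 : Z2 + L ^+ b2 * N2 ^+ j1 * (R2 \Po F) = 'X^(p ^ m) * H2.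
    apply: (exprp_inj pK); rewrite /= exprMn -exprM -expnSr -EH -E1 (exprpD pK) -EZ.
    by rewrite !exprMn -!exprM -Eb mulnC exprM -EN -rmorphXn /= -ER.
  have N2x0 : N2.[x0] != 0.
    apply: contraNneq Nx0 => N2x0; rewrite EN horner_exp N2x0 expr0n gtn_eqF //.
    exact: ltnW.
  have R20 : R2.[0] != 0.
    apply: contraNneq R10 => R20; rewrite ER horner_exp R20 expr0n gtn_eqF //.
    exact: ltnW.
  have [||||||i Ei] := IHm Z2 N2 H2 R2 a (p * Q)%N b2 j1 _ _ _ N2x0 _ _ R20 _ E2 k2 R2k.
  - by rewrite muln_gt0 Q_gt0 ltnW.
  - by rewrite dvdn_mulr.
  - by rewrite exprM -EN.
  - by rewrite exprM -EH.
  - by rewrite vj1 Eb (mulnC b2) mulnCA mulnA.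
  - move: leZ1; rewrite EZ EN !degX (mulnC _ p) => le; apply: leq_trans le _.
    by rewrite leq_add2l mulnCA mulnA (mulnC _ p) -mulnA.
  by exists i.+1; rewrite Eb mulnA -mulnDl Ei expnSr.
have leH' : (deg H <= deg L)%N by rewrite (leq_trans _ (ltnW leH)) // leq_pmull // ltnW.
have leZ' : (deg Z <= deg L + deg N * j.-1)%N.
  rewrite -(@leq_pmul2l p) ?(ltnW p_gt1) // (leq_trans leZ) // mulnDr.
  by rewrite leq_add2r leq_pmull // ltnW.
have [b_gt1|b_le1] := ltnP 1 b.
  apply: (core Z R b j) => //; rewrite -(@leq_pmul2l p) ?(ltnW p_gt1) // mulnDr.
  apply: leq_trans (leq_add leZ (ltnW leH)) _; rewrite mulnDr addnAC leq_add2r addnn.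
  by rewrite -muln2 mulnC leq_mul // leq_pmulr // -ltnS prednK.
have Eb : b = 1%N by apply/eqP; rewrite eqn_leq b_le1.
have [R_le1|R_gt1] := leqP (size R) 1.
  by exists 0%N; rewrite Eb (const_R R k) // muln0.
case: k Rk => [|k] Rk; first by exists 0%N; rewrite Eb muln0.
have nzRc : R - (R.[0])%:P != 0.
  by apply: contraTneq R_gt1 => /eqP; rewrite subr_eq0 => /eqP->; rewrite -leqNgt size_polyC_leq1.
(* Write [R = R(0) + X^s R1]. Since [F ^+ s = L ^+ (v * s) * N ^+ (Q * s)], the exponents [1] and
   [j] become [1 + v * s] and [j + Q * s], bound by the same relation. *)
have [s [R1]] := multiplicity_XsubC (R - (R.[0])%:P) 0; rewrite nzRc /= subr0 => R10 ER.
have s_gt0 : (0 < s)%N.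
  case: s ER => // ER; move: R10; rewrite -[R1]mulr1 -(expr0 'X) -ER rootE.
  by rewrite !hornerE subrr eqxx.
have [k1 Ek R1k] : exists2 k1, k.+1 = (s + k1)%N & R1`_k1 != 0.
  move: Rk; rewrite -[R](subrK (R.[0])%:P) ER coefD coefMXn coefC addr0.
  case: ltnP => [_|les]; first by rewrite eqxx.
  by exists (k.+1 - s)%N; rewrite // subnKC.
have leZp : (deg (Z + R.[0] *: (L * N ^+ j)) <= deg L + deg N * j)%N.
  apply: degD_leq; first by rewrite (leq_trans leZ') // leq_add2l leq_mul2l leq_pred orbT.
  by rewrite size_scale // degM ?expf_neq0 // degX.
have le_j : (j <= (j + Q * s).-1)%N.
  by rewrite -ltnS prednK ?addn_gt0 ?j_gt0 // -[ltnLHS]addn0 ltn_add2l muln_gt0 Q_gt0.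
have [||||||i Ei] := core (Z + R.[0] *: (L * N ^+ j)) R1 (1 + v * s)%N (j + Q * s)%N k1.
- by rewrite mulnDr addnA vj Eb; ring.
- by rewrite -rootE.
- by apply: leq_trans leZp _; rewrite leq_add2l leq_mul2l le_j orbT.
- apply: leq_trans (leq_add leZp leH') _; rewrite addnAC addnn -muln2.
  rewrite leq_add //; last by rewrite leq_mul2l le_j orbT.
  by rewrite add1n /= leq_mul2l -[2%N]muln1 leq_mul ?orbT.
- rewrite -E; have -> : R \Po F = (R1 \Po F) * F ^+ s + (R.[0])%:P.
    rewrite -{1}[R](subrK (R.[0])%:P) ER comp_polyD comp_polyM comp_polyC.
    by rewrite rmorphXn /= comp_polyX.
  set G1 := R1 \Po F.
  rewrite Eb -mul_polyC [in RHS]EF !exprMn !exprD -!exprM expr1; ring.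
- by [].
by exists i; rewrite Eb Ek mulnDr addnA.
Qed.

End MultiplePoints.

(** * Fibres of a minimal value set polynomial *)

Section MVSP.
Variables (p n : nat) (F : finFieldType) (K : closedFieldType).
Variables (iota : {rmorphism F -> K}) (f : {poly F}).
Hypotheses (p_prime : prime p) (card_F : #|F| = (p ^ n.+1)%N).
Hypotheses (f_mvsp : is_mvsp f) (card_S : (2 < #|value_set f|)%N).

Let S := value_set f.
Let d := (size f).-1.
Let g := map_poly iota f.

Let fib c : {poly K} := \prod_(x | f.[x] == c) ('X - (iota x)%:P).
Let cof c : {poly K} := (g - (iota c)%:P) %/ fib c.

Let d_gt0 : (0 < d)%N. Proof. by case: f_mvsp => f_gt1 _; rewrite -ltnS prednK // ltnW. Qed.

Let size_g : size g = d.+1.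
Proof. by rewrite size_map_poly prednK //; case: f_mvsp => /ltnW. Qed.

Lemma pchar_closure : p \in [pchar K].
Proof. exact: (rmorph_pchar iota (card_finPcharP card_F p_prime)). Qed.

Lemma horner_g x : g.[iota x] = iota f.[x].
Proof. exact: horner_map. Qed.

Lemma fib_roots c : fib c = \prod_(y <- [seq iota x | x in [pred x | f.[x] == c]]) ('X - y%:P).
Proof. by rewrite big_map big_enum /=; apply: eq_bigl. Qed.

Lemma uniq_fib c : uniq_roots [seq iota x | x in [pred x | f.[x] == c]].
Proof. by rewrite uniq_rootsE map_inj_uniq ?enum_uniq //; exact: fmorph_inj. Qed.

Lemma fib_dvdp c (A : {poly K}) : (forall x, f.[x] = c -> A.[iota x] = 0) -> fib c %| A.
Proof.
move=> rA; rewrite fib_roots; apply: uniq_roots_dvdp (uniq_fib c).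
by apply/allP => y /imageP[x /eqP fx ->]; apply/rootP/rA.
Qed.

Lemma fib_root c x : f.[x] = c -> (fib c).[iota x] = 0.
Proof.
by move=> fx; rewrite /fib (bigD1 x) ?fx ?eqxx //= hornerM !hornerE subrr mul0r.
Qed.

Lemma fib_neq0 c : fib c != 0.
Proof. by rewrite monic_neq0 // monic_prod_XsubC. Qed.

Lemma fibK c : g - (iota c)%:P = fib c * cof c.
Proof.
rewrite /cof mulrC divpK // fib_dvdp // => x fx.
by rewrite !hornerE horner_g fx subrr.
Qed.

Lemma size_gc c : size (g - (iota c)%:P) = d.+1.
Proof.
by rewrite size_polyDl ?size_g // size_polyN (leq_ltn_trans (size_polyC_leq1 _)).
Qed.

Lemma cof_neq0 c : cof c != 0.
Proof.
by apply/eqP => K0; have := size_gc c; rewrite fibK K0 mulr0 size_poly0.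
Qed.

Lemma deg_fibcof c : (deg (fib c) + deg (cof c) = d)%N.
Proof. by rewrite -degM ?fib_neq0 ?cof_neq0 // -fibK size_gc. Qed.

Lemma prod_fib : \prod_(c in S) fib c = 'X^#|F| - 'X.
Proof.
have -> : 'X^#|F| - 'X = map_poly iota ('X^#|F| - 'X).
  by rewrite rmorphB /= map_polyXn map_polyX.
rewrite finField_genPoly rmorph_prod /=.
rewrite [RHS](partition_big (fun x => f.[x]) (mem S)) /=; last first.
  by move=> x _; apply: imset_f.
apply: eq_bigr => c _; apply: eq_bigr => x _.
by rewrite rmorphB /= map_polyX map_polyC.
Qed.

(** Minimality enters here. The fibres have total degree [#|F|], so the cofactors have total degree
    [d * #|S| - #|F|], which is less than [d] because [#|S|] is [(#|F| - 1) %/ d + 1]. *)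
Lemma sum_deg_cof : (\sum_(c in S) deg (cof c) < d)%N.
Proof.
have sum_fib : (\sum_(c in S) deg (fib c) = #|F|)%N.
  have -> : #|F| = deg (\prod_(c in S) fib c).
    rewrite prod_fib size_polyDl ?size_polyXn // size_polyN size_polyX ltnS.
    by rewrite card_F expnS (leq_trans (prime_gt1 p_prime)) // leq_pmulr // expn_gt0 prime_gt0.
  suff [_ ->] : \prod_(c in S) fib c != 0 /\
      deg (\prod_(c in S) fib c) = (\sum_(c in S) deg (fib c))%N by [].
  apply: (big_ind2 (fun (A : {poly K}) k => A != 0 /\ deg A = k)).
  - by rewrite oner_neq0 size_poly1.
  - by move=> A k B l [nzA <-] [nzB <-]; rewrite mulf_neq0 // degM.
  by move=> c _; rewrite fib_neq0.
have := sum_nat_const (mem S) d.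
rewrite -(eq_bigr _ (fun c _ => deg_fibcof c)) big_split /= sum_fib.
case: f_mvsp => _ cS; rewrite -/d in cS.
have : ((#|F| - 1) %/ d * d <= #|F| - 1)%N := leq_trunc_div _ _.
have q_gt0 : (0 < #|F|)%N by apply/card_gt0P; exists 0.
rewrite cS mulnDl mul1n; move: ((#|F| - 1) %/ d * d)%N q_gt0 => y; clear.
by move: #|F| (\sum_(c in S) _)%N => q t; lia.
Qed.

(** This is the derivative at [iota c] of the product of the [X - iota e] over all values [e]. *)
Definition cst c : K := \prod_(e in S :\ c) (iota c - iota e).
Let M := \prod_(c in S) cof c.
Let cofs c := \prod_(e in S :\ c) cof e.

Lemma cst_neq0 c : cst c != 0.
Proof.
apply/prodf_neq0 => e /setD1P[ne _].
by rewrite subr_eq0 (inj_eq (fmorph_inj _)) eq_sym.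
Qed.

Lemma ME c : c \in S -> M = cof c * cofs c.
Proof. by move=> Sc; rewrite /M (big_setD1 c). Qed.

Lemma M_neq0 : M != 0.
Proof. by apply/prodf_neq0 => c _; exact: cof_neq0. Qed.

(** The derivative of [X^#|F| - X] is [-1], and on the fibre of [c] the product rule for [prod_fib]
    keeps a single term. *)
Lemma fib_derivE c x : c \in S -> f.[x] = c ->
  (fib c)^`().[iota x] * (\prod_(e in S :\ c) fib e).[iota x] = -1.
Proof.
move=> Sc fx; have := congr1 (fun A => A^`().[iota x]) prod_fib.
rewrite /= (big_setD1 c) //= derivM hornerD !hornerM (fib_root fx) mul0r addr0.
move=> ->; rewrite derivB derivXn derivX card_F.
rewrite expnS mulrnA (mulrn_pchar (pchar_polyC pchar_closure)) mul0rn.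
by rewrite sub0r hornerN hornerC.
Qed.

Lemma fib_deriv_neq0 c x : c \in S -> f.[x] = c -> (fib c)^`().[iota x] != 0.
Proof.
move=> Sc fx; apply/eqP => L'0; have /eqP := fib_derivE Sc fx.
by rewrite L'0 mul0r eq_sym oppr_eq0 oner_eq0.
Qed.

Lemma deg_cofs c : c \in S -> (deg (cofs c) < deg (fib c))%N.
Proof.
move=> Sc; have := sum_deg_cof; rewrite -(deg_fibcof c) (big_setD1 c) //= addnC ltn_add2r.
apply: leq_ltn_trans; rewrite /cofs.
apply: (big_ind2 (fun (A : {poly K}) k => deg A <= k)%N); rewrite ?size_poly1 //.
move=> A k B l leA leB; apply: leq_trans (degM_leq _ _) _; exact: leq_add.
Qed.

(** Both sides have degree less than that of [fib c], so they need only agree on the fibre, where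
    [fib e * cof e] takes the value [c - e] and [fib_derivE] applies. *)
Lemma fib_deriv c : c \in S -> cst c *: (fib c)^`() = - cofs c.
Proof.
move=> Sc; apply/eqP; rewrite -addr_eq0; apply/eqP/(@dvdp_size_eq0 _ (fib c)).
  apply: fib_dvdp => x fx; rewrite hornerD hornerZ.
  have -> : cst c = (cofs c).[iota x] * (\prod_(e in S :\ c) fib e).[iota x].
    rewrite -hornerM -big_split /= horner_prod; apply: eq_bigr => e _.
    by rewrite mulrC -fibK !hornerE horner_g fx.
  by rewrite -mulrA [X in _ * X]mulrC fib_derivE // mulrN1 addNr.
apply: leq_ltn_trans (size_polyD _ _) _; rewrite gtn_max; apply/andP; split.
  rewrite size_scale ?cst_neq0 //; exact: lt_size_deriv (fib_neq0 c).
have := deg_cofs Sc; have := fib_neq0 c; rewrite -size_poly_gt0.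
case: (size (fib c)) => // k _ /=; case: (size (cofs c)) => //= l.
Qed.

Lemma fib_deriv_cof c : c \in S -> cst c *: ((fib c)^`() * cof c) = - M.
Proof. by move=> Sc; rewrite scalerAl fib_deriv // mulNr mulrC -ME. Qed.

Lemma g_deriv c : g^`() = (fib c)^`() * cof c + fib c * (cof c)^`().
Proof. by rewrite -derivM -fibK derivB derivC subr0. Qed.

(** [g'] and [M] are common to all these relations and can be eliminated between them. The factor
    [cof c] replaces [fib c] by [g - c], which depends on [c] only through a constant. *)
Lemma g_deriv_cof c : c \in S ->
  (g^`() + (cst c)^-1 *: M) * cof c = (g - (iota c)%:P) * (cof c)^`().
Proof.
move=> Sc; rewrite (g_deriv c) fibK -[M]opprK -(fib_deriv_cof Sc) scalerN scalerA.
by rewrite mulVf ?cst_neq0 // scale1r; ring.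
Qed.

Lemma cof_coprime c e : c != e -> coprimep (cof c) (cof e).
Proof.
move=> ne; apply: Pdiv.ClosedField.root_coprimep => x /rootP cx.
apply: contraNneq ne => ex; rewrite -(inj_eq (fmorph_inj iota)).
have gx a : (cof a).[x] = 0 -> g.[x] = iota a.
  move=> ax; have := congr1 (fun A : {poly K} => A.[x]) (fibK a).
  by rewrite /= hornerM ax mulr0 !hornerE => /eqP; rewrite subr_eq0 => /eqP.
by rewrite -(gx c) // -(gx e).
Qed.

Lemma cof_dvd_deriv c e A : c != e -> cof c %| (cof c)^`() * (cof e * A) ->
  coprimep (cof c) A -> (cof c)^`() = 0.
Proof.
move=> ne dvd cop; have copM : coprimep (cof c) (cof e * A).
  by rewrite coprimepMr cof_coprime.
move: dvd; rewrite Gauss_dvdpl // => /dvdp_size_eq0; apply.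
exact: lt_size_deriv (cof_neq0 c).
Qed.

Lemma mulg_small (w u : {poly K}) : g * w = u -> (size u <= d)%N -> w = 0.
Proof.
move=> <-; apply: contraTeq => nzw; rewrite -ltnNge size_mul //; last first.
  by rewrite -size_poly_gt0 size_g.
by rewrite size_g addSn /= -[ltnLHS]addn0 ltn_add2l size_poly_gt0.
Qed.

(** * Elimination between two or three values *)

Lemma deg_cof2 i j : i \in S -> j \in S -> i != j ->
  (deg (cof i) + deg (cof j) < d)%N.
Proof.
move=> Si Sj ne; apply: leq_ltn_trans sum_deg_cof.
rewrite (big_setD1 i) //= leq_add2l (big_setD1 j) ?leq_addr //.
by rewrite !inE Sj eq_sym ne.
Qed.

Lemma deg_cof3 i j l : i \in S -> j \in S -> l \in S -> i != j -> i != l -> j != l ->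
  (deg (cof i) + (deg (cof j) + deg (cof l)) < d)%N.
Proof.
move=> Si Sj Sl ij il jl; apply: leq_ltn_trans sum_deg_cof.
rewrite (big_setD1 i) //= leq_add2l (big_setD1 j) /=; last first.
  by rewrite !inE Sj eq_sym ij.
by rewrite leq_add2l (big_setD1 l) ?leq_addr // !inE Sl ![l == _]eq_sym il jl.
Qed.

(** With equal constants, the two relations [g_deriv_cof] equate [g] times the Wronskian of the
    cofactors with a polynomial of size at most [d]. So the Wronskian is zero, and by coprimality
    [cof i] divides its own derivative. *)
Lemma cof_deriv_eq0 i j : i \in S -> j \in S -> i != j -> cst i = cst j ->
  (cof i)^`() = 0.
Proof.
move=> Si Sj ne eqc; have Ei := g_deriv_cof Si; have := g_deriv_cof Sj.
rewrite -eqc; move: (g^`() + _) Ei => A Ei Ej.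
have W0 : (cof i)^`() * cof j - (cof j)^`() * cof i = 0.
  apply: (@mulg_small _ (iota i *: ((cof i)^`() * cof j) - iota j *: ((cof j)^`() * cof i))).
    apply/eqP; rewrite -subr_eq0; apply/eqP.
    transitivity ((g - (iota i)%:P) * (cof i)^`() * cof j
                  - (g - (iota j)%:P) * (cof j)^`() * cof i).
      by rewrite -!mul_polyC; ring.
    by rewrite -Ei -Ej; ring.
  apply: leq_trans (size_polyD _ _) _; rewrite size_polyN geq_max.
  rewrite !(leq_trans (size_scale_leq _ _)) // (leq_trans (size_deriv_mul _ _)) //.
    by rewrite addnC ltnW // deg_cof2.
  by rewrite ltnW // deg_cof2.
apply: (@cof_dvd_deriv i j 1) => //; last exact: coprimep1.
by rewrite mulr1; move/eqP: W0; rewrite subr_eq0 => /eqP->; rewrite dvdp_mull.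
Qed.

Lemma cst_eq i j l : i \in S -> j \in S -> l \in S -> i != j -> i != l -> j != l ->
  (cof i)^`() != 0 -> cst j = cst l.
Proof.
move=> Si Sj Sl ij il jl; apply: contraNeq => ne; apply/eqP.
have [bi bj bl] := (And3 (g_deriv_cof Si) (g_deriv_cof Sj) (g_deriv_cof Sl)).
have nzjl : (cst j)^-1 - (cst l)^-1 != 0 by rewrite subr_eq0 (inj_eq invr_inj).
move: (cst i)^-1 (cst j)^-1 (cst l)^-1 bi bj bl nzjl => bi bj bl Ei Ej El nzjl.
(* The weights [bj - bl], [bl - bi], [bi - bj] cancel both [g'] and [M]: they sum to zero, and so do
   their products with [bi], [bj], [bl]. What is left falls under [mulg_small]. *)
pose w (x y z : K) := x *: ((cof i)^`() * (cof j * cof l)) + y *: ((cof j)^`() * (cof i * cof l))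
   + z *: ((cof l)^`() * (cof i * cof j)).
have W0 : w (bj - bl) (bl - bi) (bi - bj) = 0.
  apply: (@mulg_small _ (w (iota i * (bj - bl)) (iota j * (bl - bi)) (iota l * (bi - bj)))).
    apply/eqP; rewrite -subr_eq0; apply/eqP.
    transitivity ((bj - bl) *: ((g - (iota i)%:P) * (cof i)^`() * (cof j * cof l))
      + (bl - bi) *: ((g - (iota j)%:P) * (cof j)^`() * (cof i * cof l))
      + (bi - bj) *: ((g - (iota l)%:P) * (cof l)^`() * (cof i * cof j))).
      by rewrite /w -!mul_polyC !(polyCM, polyCB); ring.
    by rewrite -Ei -Ej -El -!mul_polyC !polyCB; ring.
  have le x (A B C : {poly K}) : (deg A + (deg B + deg C) < d)%N ->
      (size (x *: (A^`() * (B * C))) <= d)%N.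
    move=> lt; apply: leq_trans (size_scale_leq _ _) _; apply: leq_trans (size_deriv_mul _ _) _.
    by apply: leq_trans (ltnW lt); rewrite leq_add2l degM_leq.
  have := deg_cof3 Si Sj Sl ij il jl => lt.
  apply: leq_trans (size_polyD _ _) _; rewrite geq_max (le _ _ _ _ _) ?andbT; last first.
    by rewrite addnC -addnA.
  apply: leq_trans (size_polyD _ _) _; rewrite geq_max !le //.
  by rewrite addnCA.
apply: (cof_dvd_deriv (e := j) (A := cof l)); rewrite ?cof_coprime //.
rewrite -(@dvdpZr _ (bj - bl)) //.
have -> : (bj - bl) *: ((cof i)^`() * (cof j * cof l)) =
  - (cof i * ((bl - bi) *: ((cof j)^`() * cof l) + (bi - bj) *: ((cof l)^`() * cof j))).
  apply/eqP; rewrite -subr_eq0 opprK; apply/eqP; rewrite -W0 /w -!mul_polyC; ring.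
by rewrite dvdpNr dvdp_mulr.
Qed.

(** As [g - c = fib c * cof c], this says that every point of the fibre is a multiple root of
    [g - c]. *)
Definition degenerate c := fib c %| cof c.

Lemma fib_dvd_cof c : c \in S -> fib c %| (fib c)^`() * cof c -> degenerate c.
Proof.
move=> Sc dvd; apply: fib_dvdp => x fx; apply/eqP.
have [A EA] := dvdpP _ _ dvd.
have /eqP := congr1 (fun B : {poly K} => B.[iota x]) EA.
by rewrite !hornerM (fib_root fx) mulr0 mulf_eq0 (negPf (fib_deriv_neq0 Sc fx)).
Qed.

(** The cofactor of a degenerate value has degree at least [d / 2], whereas two cofactors have total
    degree less than [d]. *)
Lemma degenerate_uniq i j : i \in S -> j \in S -> degenerate i -> degenerate j -> i = j.
Proof.
move=> Si Sj /dvdp_leq-/(_ (cof_neq0 i)) le_i /dvdp_leq-/(_ (cof_neq0 j)) le_j.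
apply: contraTeq isT => /(deg_cof2 Si Sj); have := deg_fibcof i; have := deg_fibcof j.
have := fib_neq0 i; have := fib_neq0 j; rewrite -!size_poly_gt0.
move: le_i le_j; size_lia.
Qed.

(** Two further values [j], [l] have equal constants, which fixes [g' = - M / cst j]. In the
    relation for [i] this makes [fib i] divide [M], hence [(fib i)' * cof i], and [fib i] has only
    simple roots. *)
Lemma cof_deriv_degenerate i : i \in S -> (cof i)^`() != 0 -> degenerate i.
Proof.
move=> Si nzi; apply: fib_dvd_cof => //.
have [j [l [Sj Sl ij il jl]]] : exists j l, [/\ j \in S, l \in S, i != j, i != l & j != l].
  have : (1 < #|S :\ i|)%N by have := cardsD1 i S; rewrite Si; move: card_S; rewrite -/S; lia.
  case/card_gt1P=> j [l [/setD1P[ij Sj] /setD1P[il Sl] jl]].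
  by exists j, l; rewrite ![i == _]eq_sym.
have eq_jl := cst_eq Si Sj Sl ij il jl nzi.
have K'j := cof_deriv_eq0 Sj Sl jl eq_jl.
have Eg : g^`() + (cst j)^-1 *: M = 0.
  have /eqP := g_deriv_cof Sj; rewrite K'j mulr0 mulf_eq0 (negPf (cof_neq0 j)) orbF.
  by move/eqP.
have ne : (cst i)^-1 - (cst j)^-1 != 0.
  rewrite subr_eq0 (inj_eq invr_inj); apply: contraNneq nzi => eq_ij.
  by rewrite (cof_deriv_eq0 Si Sj ij eq_ij).
have Ei : ((cst i)^-1 - (cst j)^-1) *: M = fib i * (cof i)^`().
  apply: (mulIf (cof_neq0 i)); rewrite [RHS]mulrAC -fibK -(g_deriv_cof Si).
  by rewrite -[g^`()](addrK ((cst j)^-1 *: M)) Eg -!mul_polyC polyCB; ring.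
have: fib i %| ((cst i)^-1 - (cst j)^-1) *: M by rewrite Ei dvdp_mulr.
rewrite dvdpZr // -dvdpNr -(fib_deriv_cof Si) dvdpZr //; exact: cst_neq0.
Qed.

(** As [g'] does not depend on [i], all nondegenerate values share one constant. *)
Lemma nondegenerate_deriv i : i \in S -> ~~ degenerate i ->
  (cof i)^`() = 0 /\ g^`() = - (cst i)^-1 *: M.
Proof.
move=> Si ndi; have K'i : (cof i)^`() = 0.
  by apply/eqP; apply: contraNT ndi; exact: cof_deriv_degenerate.
split=> //; apply/eqP; have /eqP := g_deriv_cof Si.
rewrite K'i mulr0 mulf_eq0 (negPf (cof_neq0 i)) orbF.
by rewrite addr_eq0 scaleNr.
Qed.

Lemma nondegenerate_point i : i \in S -> ~~ degenerate i ->
  exists2 x, f.[x] = i & g^`().[iota x] != 0.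
Proof.
move=> Si ndi; have [/existsP[x /andP[/eqP fx nz]]|/existsPn no] :=
  boolP [exists x, (f.[x] == i) && (g^`().[iota x] != 0)]; first by exists x.
case/negP: ndi; apply: fib_dvdp => x fx; apply/eqP.
have := no x; rewrite fx eqxx /= negbK (g_deriv i) hornerD !hornerM (fib_root fx).
by rewrite mul0r addr0 mulf_eq0 (negPf (fib_deriv_neq0 Si fx)).
Qed.

Lemma root_cof c y : (cof c).[y] = 0 -> g.[y] = iota c.
Proof.
move=> cy; have := congr1 (fun A : {poly K} => A.[y]) (fibK c).
by rewrite /= hornerM cy mulr0 !hornerE => /eqP; rewrite subr_eq0 => /eqP.
Qed.

Lemma root_prod_cof (P : pred F) y : (\prod_(c | P c) cof c).[y] = 0 ->
  exists2 c, P c & g.[y] = iota c.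
Proof.
rewrite horner_prod => /eqP/prodf_eq0[c Pc /eqP/root_cof gy]; by exists c.
Qed.

(** * Exponents of the polynomial whose roots are the nonzero values *)

Lemma prod_cof_deriv0 (P : pred F) : (forall c, P c -> (cof c)^`() = 0) ->
  (\prod_(c | P c) cof c)^`() = 0.
Proof.
move=> h; apply: (big_rec (fun A : {poly K} => A^`() = 0)) => [|c A Pc A'0].
  exact: derivC.
by rewrite derivM A'0 h // mul0r mulr0 addr0.
Qed.

(** Values outside [S] are attained because [K] is algebraically closed, and no zero of [A] lies
    above them. *)
Lemma g_onto (P : pred K) (A : {poly K}) :
  (forall c, c \in S -> P (iota c) -> exists2 x, f.[x] = c & A.[iota x] != 0) ->
  (forall y, A.[y] = 0 -> exists2 c, c \in S & g.[y] = iota c) ->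
  forall z, P z -> exists2 x, g.[x] = z & A.[x] != 0.
Proof.
move=> onS rootA z Pz.
have [/existsP[c /andP[Sc /eqP zc]]|/existsPn no] := boolP [exists c in S, iota c == z].
  have [|x fx Ax] := onS c Sc; first by rewrite zc.
  by exists (iota x); rewrite // horner_g fx.
have [|x /rootP] := closed_rootP (g - z%:P) _.
  by rewrite size_polyDl ?size_g ?size_polyN ?(leq_ltn_trans (size_polyC_leq1 _)) // eqSS -lt0n.
rewrite !hornerE => /eqP; rewrite subr_eq0 => /eqP gx; exists x => //.
apply/eqP => /rootA[c Sc gc]; have := no c.
by rewrite Sc -gc gx eqxx.
Qed.

(** All values share the constant [c], so [T = c X + P^p], and [T(g) = (X^#|F| - X) * M] yields an
    identity of p-th powers whose root is the input of [comp_exponents]. The conclusion has the form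
    of the degenerate case with [v = 1]. *)
Lemma exponents_nondegenerate : 0 \in S -> (forall c, c \in S -> ~~ degenerate c) ->
  forall j, (\prod_(e in S :\ 0) ('X - (iota e)%:P))`_j != 0 -> exists i, (1 + 1 * j = p ^ i)%N.
Proof.
move=> S0 nd j T0j; have pK := pchar_closure.
have [_ Eg'] := nondegenerate_deriv S0 (nd 0 S0); set c := cst 0 in Eg'.
have nzc : c != 0 by exact: cst_neq0.
have cstE e : e \in S -> cst e = c.
  move=> Se; have [_] := nondegenerate_deriv Se (nd e Se).
  rewrite Eg' => /eqP; rewrite -subr_eq0 -scalerBl scaler_eq0 (negPf M_neq0) orbF.
  by rewrite subr_eq0 eqr_opp (inj_eq invr_inj) => /eqP.
pose T := \prod_(e in S) ('X - (iota e)%:P).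
have ET : T = 'X * \prod_(e in S :\ 0) ('X - (iota e)%:P).
  by rewrite /T (big_setD1 0) //= rmorph0 subr0.
have Tj : T`_j.+1 != 0 by rewrite ET coefXM.
(* [T'] takes the value [cst e = c] at each of the [#|S|] values, while [T' - c] has size at most
   [#|S|]. *)
have T'E : T^`() = c%:P.
  apply/eqP; rewrite -subr_eq0; apply: contraTT isT => nz.
  have := max_poly_roots nz (rs := [seq iota e | e in S]).
  rewrite map_inj_uniq ?enum_uniq; last exact: fmorph_inj.
  rewrite size_map -cardE => /(_ _ isT) lt.
  suff: (#|S| < #|S|)%N by rewrite ltnn.
  apply: leq_trans (lt _) _.
    apply/allP => y /imageP[e Se ->]; apply/rootP.
    rewrite /T (big_setD1 e) //= derivM derivXsubC mul1r !hornerE subrr mul0r addr0.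
    rewrite -(cstE e Se) horner_prod; apply/eqP; rewrite subr_eq0; apply/eqP.
    by apply: eq_bigr => e' _; rewrite !hornerE.
  apply: leq_trans (size_polyD _ _) _; rewrite geq_max size_polyN.
  rewrite (leq_trans (size_polyC_leq1 _)) ?andbT; last by rewrite ltnW // ltnW.
  have nzT : T != 0 by rewrite monic_neq0 // monic_prod_XsubC.
  have sT : size T = #|S|.+1 by rewrite /T -big_enum size_prod_XsubC -cardE.
  by rewrite -ltnS -sT lt_size_deriv.
have [P EP] : exists P, T - c *: 'X = P ^+ p.
  by apply: (deriv_eq0_exprp pK); rewrite derivB derivZ derivX T'E alg_polyC subrr.
have g''0 : g^`()^`() = 0.
  rewrite Eg' derivZ prod_cof_deriv0 ?scaler0 // => e Se.
  by case: (nondegenerate_deriv Se (nd e Se)).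
have [H EH] : exists H, - c *: g^`() = H ^+ p.
  by apply: (deriv_eq0_exprp pK); rewrite derivZ g''0 scaler0.
have [Z EZ] : exists Z, c *: (g - 'X * g^`()) = Z ^+ p.
  apply: (deriv_eq0_exprp pK); rewrite derivZ derivB derivM g''0 derivX.
  by rewrite mul1r mulr0 addr0 subrr scaler0.
have ETg : T \Po g = ('X^#|F| - 'X) * M.
  rewrite -prod_fib -big_split rmorph_prod /=; apply: eq_bigr => e _.
  by rewrite comp_polyB comp_polyX comp_polyC -fibK.
(* This is the p-th root of [c (g - X g') + P(g)^p = X^#|F| (- c g')], which is [ETg] with
   [M = - c g']. *)
have E : Z + (P \Po g) = 'X^(p ^ n) * H.
  apply: (exprp_inj pK); rewrite /= (exprpD pK) exprMn -exprM -expnSr -card_F -EZ -EH.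
  rewrite -rmorphXn /= -EP comp_polyB ETg comp_polyZ comp_polyX.
  have -> : M = - c *: g^`().
    by rewrite Eg' scalerA mulrNN mulfV ?scale1r.
  by rewrite -!mul_polyC polyCN; ring.
have onto z : exists2 x, g.[x] = z & g^`().[x] != 0.
  apply: (@g_onto xpredT) => // [e Se _|y]; first exact: nondegenerate_point Se (nd e Se).
  rewrite Eg' hornerZ => /eqP; rewrite mulf_eq0 oppr_eq0 invr_eq0 (negPf nzc) /=.
  by move/eqP/root_prod_cof.
have Eg2 : g^`() = (- c)^-1 *: H ^+ p.
  by rewrite -EH scalerA mulVf ?scale1r // oppr_eq0.
have leZ : (p * deg Z <= deg g)%N.
  rewrite mulnC -degX -EZ size_scale //; apply: degD_leq => //.
  rewrite size_polyN; apply: leq_trans (degM_leq _ _) _; rewrite size_polyX.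
  have nzg : g != 0 by rewrite -size_poly_gt0 size_g.
  by have := lt_size_deriv nzg; rewrite size_g /= add1n; case: (size g^`()).
have := Tj; rewrite -[T](subrK (c *: 'X)) EP coefD coefZ coefX (coef_exprp pK).
case: j {T0j Tj} => [|j] /=; first by exists 0%N.
rewrite mulr0 addr0 add1n mul1n; case: ifP => [/dvdnP[k Ej]|_]; last by rewrite eqxx.
rewrite Ej mulnK ?prime_gt0 // expf_eq0 prime_gt0 //= => Pk.
have [k0|[i Ei]] := comp_exponents pK onto Eg2 (leqnn p) leZ E Pk.
  by rewrite k0 in Ej.
by exists i.+1; rewrite Ei expnSr.
Qed.

Lemma exponents_degenerate : 0 \in S -> degenerate 0 -> exists2 v, (0 < v)%N &
  forall j, (\prod_(e in S :\ 0) ('X - (iota e)%:P))`_j != 0 -> exists i, (1 + v * j = p ^ i)%N.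
Proof.
move=> S0 dg0; have pK := pchar_closure; have p_gt1 := prime_gt1 p_prime.
pose L := fib 0; pose c := cst 0; have nzc : c != 0 by exact: cst_neq0.
have nd e : e \in S :\ 0 -> ~~ degenerate e.
  case/setD1P=> ne Se; apply: contraNN ne => dge.
  by rewrite (degenerate_uniq Se S0 dge dg0).
have [e0 Se0] : exists e, e \in S :\ 0.
  have : (0 < #|S :\ 0%R|)%N.
    by move: card_S; rewrite -/S (cardsD1 0%R S) S0 add1n ltnS; exact: ltnW.
  by case/card_gt0P => e Se; exists e.
pose b := (cst e0)^-1.
have nzb : b != 0 by rewrite invr_eq0 cst_neq0.
have Eg' : g^`() = - b *: M.
  by have /setD1P[_ Se] := Se0; have [] := nondegenerate_deriv Se (nd e0 Se0).
have EL' : c *: L^`() = - cofs 0 by exact: fib_deriv.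
have L''0 : L^`()^`() = 0.
  have /eqP : c *: L^`()^`() = 0.
    rewrite -derivZ EL' derivN prod_cof_deriv0 ?oppr0 // => e Se.
    by case/setD1P: (Se) => _ Se'; case: (nondegenerate_deriv Se' (nd e Se)).
  by rewrite scaler_eq0 (negPf nzc) => /eqP.
have gE : g = L * cof 0 by rewrite -fibK rmorph0 subr0.
(* [g'] and [L' * cof 0] are both multiples of [M], so the logarithmic derivatives of [g] and [L]
   are proportional. *)
have EgL : g^`() * L = (b * c) *: (L^`() * g).
  have := fib_deriv_cof S0; rewrite -/L -/c => EM.
  rewrite Eg' gE.
  have -> : (b * c) *: (L^`() * (L * cof 0)) = b *: ((c *: (L^`() * cof 0)) * L).
    by rewrite -!mul_polyC polyCM; ring.
  by rewrite EM -!mul_polyC polyCN; ring.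
have L'_root y : L^`().[y] = 0 -> exists2 e, e \in S :\ 0 & g.[y] = iota e.
  move=> L'y; apply: root_prod_cof.
  have /(congr1 (fun A : {poly K} => A.[y])) := EL'.
  by rewrite /= hornerZ L'y mulr0 hornerN => /esym/eqP; rewrite oppr_eq0 => /eqP.
have L'cop y : L^`().[y] = 0 -> g.[y] != 0.
  by case/L'_root=> e /setD1P[ne _] ->; rewrite fmorph_eq0.
have onto z : z != 0 -> exists2 x, g.[x] = z & L^`().[x] != 0.
  apply: (@g_onto (fun z => z != 0)) => [e Se|y /L'_root[e /setD1P[_ Se]]]; last by exists e.
  rewrite fmorph_eq0 => ne; have Se' : e \in S :\ 0 by rewrite !inE ne.
  have [x fx g'x] := nondegenerate_point Se (nd e Se'); exists x => //.
  apply: contraNneq g'x => L'x; have := fib_deriv_cof S0; rewrite -/L -/c => EM.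
  have := congr1 (fun A : {poly K} => A.[iota x]) EM.
  rewrite /= hornerZ hornerM L'x mul0r mulr0 hornerN Eg' hornerZ => /esym/eqP.
  by rewrite oppr_eq0 => /eqP->; rewrite mulr0.
have nzL : L != 0 by exact: fib_neq0.
have nzg : g != 0 by rewrite -size_poly_gt0 size_g.
have L_gt1 : (1 < size L)%N.
  have := deg_cofs S0; rewrite -/L; case: (size L) => [|[|k]] //.
have [v [N gLN ndN]] : exists v, exists2 N, g = L ^+ v * N & ~~ (L %| N).
  have ex : exists k, L ^+ k %| g by exists 0%N; rewrite expr0 dvd1p.
  have bd k : L ^+ k %| g -> (k <= size g)%N.
    move/(dvdp_leq nzg); apply: leq_trans; rewrite (leq_trans _ (leq_pred _)) //.
    by rewrite degX leq_pmull // -ltnS prednK // ltnW.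
  case: (ex_maxnP ex bd) => v /dvdpP[N gN] vmax; exists v, N; first by rewrite mulrC.
  apply/negP => /dvdpP[A EA]; have /vmax : L ^+ v.+1 %| g.
    by rewrite gN EA exprS -mulrA dvdp_mull.
  by rewrite ltnn.
(* Degeneracy gives [L ^+ 2 %| g]. *)
have v_gt1 : (1 < v)%N.
  rewrite ltnNge; apply: contra ndN => v_le1.
  have /dvdpP[A EA] : L %| cof 0 by exact: dg0.
  have : L ^+ 2 %| L ^+ v * N by rewrite -gLN gE EA mulrCA expr2 dvdp_mulIr.
  move: v_le1; case: v {gLN} => [|[|v]] // _.
    by rewrite expr0 mul1r; apply: dvdp_trans; rewrite expr2 dvdp_mulr.
  by rewrite expr1 expr2 dvdp_mul2l.
have [x1 fx1 Nx1] : exists2 x, f.[x] = 0 & N.[iota x] != 0.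
  have [/existsP[x /andP[/eqP fx nz]]|/existsPn no] :=
    boolP [exists x, (f.[x] == 0) && (N.[iota x] != 0)]; first by exists x.
  case/negP: ndN; apply: fib_dvdp => x fx; apply/eqP.
  by have := no x; rewrite fx eqxx /= negbK.
have L'x1 : L^`().[iota x1] != 0 by exact: fib_deriv_neq0.
have Lx1 : L.[iota x1] = 0 by exact: fib_root.
have ELN : v%:R *: (L^`() * N) + L * N^`() = (b * c) *: (L^`() * N).
  apply: (mulfI (expf_neq0 v nzL)); move: EgL; rewrite gLN derivM deriv_exp => EgL.
  rewrite -[RHS](_ : (b * c) *: (L^`() * (L ^+ v * N)) = _); last by rewrite -!mul_polyC; ring.
  rewrite -EgL; case: (v) v_gt1 => // v0 _; rewrite exprS /= -mul_polyC polyC_natr; ring.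
have vbc : v%:R = b * c.
  have := congr1 (fun A : {poly K} => A.[iota x1]) ELN.
  rewrite /= hornerD !hornerZ !hornerM Lx1 mul0r addr0 => /eqP.
  rewrite -subr_eq0 -mulrBl mulf_eq0 mulf_eq0 (negPf Nx1) (negPf L'x1) !orbF.
  by rewrite subr_eq0 => /eqP.
have p_ndvd_v : ~~ (p %| v)%N by rewrite -(natr_pchar_neq0 pK) vbc mulf_neq0.
have N'0 : N^`() = 0.
  apply/eqP; move/eqP: ELN; rewrite vbc addrC -subr_eq0 addrK mulf_eq0 (negPf nzL).
  by [].
have [N1 EN] := deriv_eq0_exprp pK N'0.
pose T := \prod_(e in S :\ 0) ('X - (iota e)%:P).
have ETg : L * (T \Po g) = - c *: (('X^#|F| - 'X) * L^`()).
  have -> : L * (T \Po g) = ('X^#|F| - 'X) * cofs 0.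
    rewrite -prod_fib (big_setD1 0) //= -mulrA -big_split rmorph_prod /=; congr (_ * _).
    by apply: eq_bigr => e _; rewrite comp_polyB comp_polyX comp_polyC -fibK.
  by rewrite -[cofs 0]opprK -EL' -!mul_polyC polyCN; ring.
have T0 : T.[0] = c.
  by rewrite horner_prod; apply: eq_bigr => e _; rewrite !hornerE rmorph0 sub0r.
pose W := T - c%:P.
(* Differentiating [ETg], replacing [L g'] by [v L' g] and cancelling [L'] gives this relation
   composed with [g]. It forces [p %| 1 + v * j] for each exponent [j] of [W]. *)
have EW : W + v%:R *: ('X * W^`()) = 0.
  have nzL' : L^`() != 0 by apply: contraNneq L'x1 => ->; rewrite horner0.
  have g_gt1 : (1 < size g)%N by rewrite size_g.
  apply/eqP; rewrite -(comp_poly_eq0 _ g_gt1) -(mulrI_eq0 _ (mulfI nzL')).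
  have := congr1 deriv ETg; rewrite derivZ !derivM L''0 mulr0 addr0 derivB derivX.
  rewrite card_F expnSr exprM (deriv_exprp pK) sub0r deriv_comp => E.
  rewrite derivB derivC subr0 comp_polyD comp_polyB comp_polyC comp_polyZ comp_polyM comp_polyX.
  have -> : L^`() * ((T \Po g) - c%:P + v%:R *: (g * (T^`() \Po g))) =
     L^`() * (T \Po g) + (T^`() \Po g) * (v%:R *: (L^`() * g)) - c *: L^`().
    by rewrite -!mul_polyC; ring.
  rewrite vbc -EgL; have -> : (T^`() \Po g) * (g^`() * L) = L * ((T^`() \Po g) * g^`()) by ring.
  by rewrite E -!mul_polyC polyCN; apply/eqP; ring.
have nzW : W != 0.
  rewrite subr_eq0; apply/eqP => Tc.
  have := size_prod_XsubC (enum (S :\ 0)) (fun e => iota e); rewrite -cardE big_enum -/T Tc.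
  have := size_polyC_leq1 c; rewrite (cardsD1 e0) Se0 => le e; by rewrite e in le.
have [j0 [W1 W10 EWj]] := multiplicity_XsubC W 0; rewrite nzW /= rootE in W10.
rewrite subr0 in EWj.
have j0_gt0 : (0 < j0)%N.
  rewrite lt0n; apply/negP => /eqP j00; move: W10; apply/negP; rewrite negbK.
  by rewrite -[W1]mulr1 -(expr0 'X) -j00 -EWj /W !hornerE T0 subrr.
have EW1 : (1 + v * j0)%:R *: W1 + v%:R *: ('X * W1^`()) = 0.
  apply: (mulfI (monic_neq0 (monicXn K j0))); rewrite mulr0 -EW EWj derivM derivXn.
  rewrite -!mul_polyC !polyC_natr natrD natrM; case: (j0) j0_gt0 => // j1 _.
  rewrite exprS /=; ring.
have p_dvd : (p %| 1 + v * j0)%N.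
  rewrite (dvdn_pcharf pK); have /eqP := congr1 (fun A : {poly K} => A.[0]) EW1.
  rewrite hornerD !hornerZ hornerM hornerX mul0r mulr0 addr0 horner0.
  by rewrite mulf_eq0 (negPf W10) orbF.
have W1'0 : W1^`() = 0.
  apply/eqP; move/eqP: EW1; have := p_dvd; rewrite (dvdn_pcharf pK) => /eqP->.
  rewrite scale0r add0r scaler_eq0 mulf_eq0 polyX_eq0 orFb.
  by rewrite (negPf (_ : v%:R != 0)) // (natr_pchar_neq0 pK).
have [R ER] := deriv_eq0_exprp pK W1'0.
have [H EH] : exists H, - c *: L^`() = H ^+ p.
  by apply: (deriv_eq0_exprp pK); rewrite derivZ L''0 scaler0.
have [Z EZ] : exists Z, c *: (L - 'X * L^`()) = Z ^+ p.
  apply: (deriv_eq0_exprp pK); rewrite derivZ derivB derivM L''0 derivX.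
  by rewrite mul1r mulr0 addr0 subrr scaler0.
have [b1 Eb1] := dvdnP p_dvd.
(* This is the p-th root of [c (L - X L') + L W(g) = X^#|F| (- c L')]; the factor
   [L g^j0 = L ^+ (1 + v * j0) * N ^+ j0] is a p-th power. *)
have E : Z + L ^+ b1 * N1 ^+ j0 * (R \Po g) = 'X^(p ^ n) * H.
  apply: (exprp_inj pK); rewrite /= (exprpD pK) !exprMn -!exprM -expnSr -card_F -EZ -EH.
  rewrite -Eb1 (mulnC j0) [N1 ^+ _]exprM -EN -rmorphXn /= -ER.
  have -> : L ^+ (1 + v * j0) * N ^+ j0 * (W1 \Po g) = L * (W \Po g).
    rewrite EWj comp_polyM rmorphXn /= comp_polyX.
    have -> : g ^+ j0 = (L ^+ v * N) ^+ j0 by rewrite -gLN.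
    by rewrite exprD expr1 exprM exprMn; ring.
  rewrite comp_polyB comp_polyC mulrBr ETg -!mul_polyC polyCN; ring.
have gLN1 : g = L ^+ v * N1 ^+ p by rewrite -EN.
have N1x1 : N1.[iota x1] != 0.
  by apply: contraNneq Nx1 => N0; rewrite EN horner_exp N0 expr0n gtn_eqF // ltnW.
have EL'2 : L^`() = (- c)^-1 *: H ^+ p.
  by rewrite -EH scalerA mulVf ?scale1r // oppr_eq0.
have R0 : R.[0] != 0.
  by apply: contraNneq W10 => R0; rewrite ER horner_exp R0 expr0n gtn_eqF // ltnW.
have leZ : (p * deg Z <= deg L + p * (deg N1 * j0.-1))%N.
  apply: leq_trans (leq_addr _ _); rewrite mulnC -degX -EZ size_scale //; apply: degD_leq => //.
  rewrite size_polyN; apply: leq_trans (degM_leq _ _) _; rewrite size_polyX.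
  have := lt_size_deriv nzL; rewrite add1n.
  by case: (size L^`()) => [|k] /=; case: (size L) L_gt1 => [|[|l]].
exists v; first exact: ltnW.
move=> j; have -> : \prod_(e in S :\ 0) ('X - (iota e)%:P) = W + c%:P by rewrite subrK.
rewrite coefD EWj coefMXn coefC; case: j => [|j]; first by exists 0%N; rewrite muln0.
rewrite addr0; case: ltnP => [_|le_j]; first by rewrite eqxx.
rewrite ER (coef_exprp pK); case: ifP => [/dvdnP[k Ek]|_]; last by rewrite eqxx.
rewrite Ek mulnK ?prime_gt0 // expf_eq0 prime_gt0 //= => Rk.
have vj : (1 + v * j0 = p * b1)%N by rewrite Eb1 mulnC.
have [i Ei] := comp_exponents_mul pK v_gt1 p_ndvd_v Lx1 L'cop onto (ltnW p_gt1)
  (dvdnn p) gLN1 N1x1 EL'2 vj R0 leZ E Rk.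
exists i.+1; rewrite -(subnKC le_j) Ek mulnDr addnA vj expnS -Ei; ring.
Qed.

End MVSP.

(** * Value sets as powers of subspaces *)

Definition power_subspace (p : nat) (F : finFieldType) (S : {set F}) : Prop :=
  exists (a b : F) (U : {set F}) (v k : nat),
     [/\ a != 0,
         (1 <= k)%N /\ is_Fm_subspace (p ^ k) U /\ 1 \in U,
         (1 <= v)%N /\ (v %| p ^ k - 1)%N &
         S = affine_image a b (power_set_image U v)].

Lemma power_subspaceP (p : nat) (F : finFieldType) (S : {set F}) (a b : F) (U : {set F}) v k :
    a != 0 -> (1 <= k)%N -> is_Fm_subspace (p ^ k) U -> 1 \in U ->
    (1 <= v)%N -> (v %| p ^ k - 1)%N ->
    (forall s, s \in S <-> exists2 u, u \in U & s = a * u ^+ v + b) ->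
  power_subspace p S.
Proof.
move=> nza k_gt0 Ufm U1 v_gt0 dvd_v SE; exists a, b, U, v, k; split=> //.
apply/setP => s; apply/idP/imsetP => [/SE[u Uu ->]|[_ /imsetP[u Uu ->] ->]].
  by exists (u ^+ v) => //; apply: imset_f.
by apply/SE; exists u.
Qed.

Lemma power_subspace_translate p (F : finFieldType) (S : {set F}) (c : F) :
  power_subspace p [set s - c | s in S] -> power_subspace p S.
Proof.
case=> a [b [U [v [k [nza [k_gt0 [Ufm U1]] [v_gt0 dvd_v] SE]]]]].
apply: (@power_subspaceP _ _ _ a (b + c) U v k) => // s; split=> [Ss|[u Uu ->]].
  have: s - c \in [set s - c | s in S] by exact: imset_f.
  rewrite SE => /imsetP[_ /imsetP[u Uu ->] E]; exists u => //.
  by rewrite addrA -E subrK.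
have: a * u ^+ v + b \in [set s - c | s in S].
  by rewrite SE; apply/imsetP; exists (u ^+ v) => //; apply: imset_f.
by case/imsetP => t St; rewrite addrA => ->; rewrite subrK.
Qed.

(** * Nonzero values forming a coset of roots of unity *)

Section CyclicShape.
Variables (p n : nat) (F : finFieldType).
Hypothesis card_F : #|F| = (p ^ n.+1)%N.

(** The multiplicative group of [F] is cyclic, so its subgroup of order [r] is the image of the
    power map whose exponent is the index [(#|F| - 1) / r]. *)
Lemma unity_root_pow (r : nat) (rs : seq F) : (0 < r)%N -> uniq rs -> size rs = r ->
    all r.-unity_root rs ->
  exists2 w, (0 < w)%N /\ (w %| #|F| - 1)%N &
    forall y, y \in rs <-> exists2 u, u != 0 & y = u ^+ w.
Proof.
move=> r_gt0 Urs sz_rs rs1; have q_gt1 : (1 < #|F|)%N := finNzRing_gt1 F.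
have expF (x : F) : x != 0 -> x ^+ (#|F| - 1) = 1.
  move=> nz; apply: (mulfI nz); rewrite mulr1 -exprS subn1 prednK ?expf_card //.
  exact: ltnW.
have mem_rs y : y ^+ r = 1 -> y \in rs.
  move=> y1; apply: contraT => nin; have := max_unity_roots r_gt0 (rs := y :: rs).
  by rewrite /= rs1 nin Urs sz_rs ltnn unity_rootE y1 eqxx => /(_ isT isT).
have rsE y : y \in rs -> y ^+ r = 1 by move/(allP rs1); rewrite unity_rootE => /eqP.
have /hasP[z z_rs prim_z] : has r.-primitive_root rs by apply: has_prim_root => //; rewrite sz_rs.
have nz_rs y : y \in rs -> y != 0.
  move/rsE => y1; apply/eqP => y0; move/eqP: y1.
  by rewrite y0 expr0n gtn_eqF // eq_sym oner_eq0.
have r_dvd : (r %| #|F| - 1)%N by rewrite (prim_order_dvd prim_z) expF ?nz_rs.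
have q1_gt0 : (0 < #|F| - 1)%N by rewrite subn_gt0.
pose w := ((#|F| - 1) %/ r)%N; have Ew : (w * r = #|F| - 1)%N by rewrite divnK.
have w_gt0 : (0 < w)%N by rewrite divn_gt0 // dvdn_leq.
exists w; first by rewrite -Ew dvdn_mulr.
move=> y; split=> [rsy|[u nzu ->]]; last by apply: mem_rs; rewrite -exprM Ew expF.
have /hasP[h _ prim_h] : has (#|F| - 1).-primitive_root (enum [set~ (0 : F)]).
  apply: has_prim_root => //; rewrite ?enum_uniq //.
    by apply/allP => x; rewrite mem_enum !inE unity_rootE => /expF->.
  by rewrite -cardE cardsC1 subn1.
have [[i _] /= Ey] := prim_rootP prim_h (expF y (nz_rs y rsy)).
have : (#|F| - 1 %| i * r)%N by rewrite (prim_order_dvd prim_h) exprM -Ey rsE.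
rewrite -Ew dvdn_pmul2r // => /dvdnP[k Ek].
exists (h ^+ k); last by rewrite Ey Ek exprM.
rewrite expf_neq0 //; apply: contraTneq prim_h => ->; apply/negP => /prim_expr_order/eqP.
by rewrite expr0n gtn_eqF // eq_sym oner_eq0.
Qed.

(** The subspace is all of [F], over itself, and the exponent is the index from [unity_root_pow]. *)
Lemma cyclic_shape (S : {set F}) (s1 : F) (r : nat) : (0 < r)%N ->
    0 \in S -> s1 \in S -> s1 != 0 -> #|S :\ 0| = r ->
    (forall s, s \in S -> s != 0 -> (s / s1) ^+ r = 1) ->
  power_subspace p S.
Proof.
move=> r_gt0 S0 Ss1 nzs1 cardS pow1.
pose rs := [seq s / s1 | s in S :\ 0].
have [||| w [w_gt0 w_dvd] rsP] := @unity_root_pow r rs r_gt0.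
- by rewrite map_inj_uniq ?enum_uniq // => x y /(mulIf (invr_neq0 nzs1)).
- by rewrite size_map -cardE.
- apply/allP => y /imageP[s /setD1P[nzs Ss] ->].
  by rewrite unity_rootE pow1.
apply: (@power_subspaceP p F S s1 0 setT w n.+1) => //.
- exists setT; split; rewrite ?cardsT //; last by split=> [|u v _ _|c u _ _]; rewrite inE.
  by split=> [|x y _ _|x y _ _]; rewrite inE.
- by rewrite inE.
- by rewrite -card_F.
move=> s; split=> [Ss|[u _ ->]].
  have [->|nzs] := eqVneq s 0.
    by exists 0; rewrite ?inE // expr0n gtn_eqF // mulr0 addr0.
  have /rsP[u nzu Eu] : s / s1 \in rs by apply/imageP; exists s; rewrite // !inE nzs.
  by exists u; rewrite ?inE // addr0 -Eu mulrC divfK.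
rewrite addr0; have [->|nzu] := eqVneq u 0; first by rewrite expr0n gtn_eqF // mulr0.
have /imageP[t /setD1P[_ St] Et] : u ^+ w \in rs by apply/rsP; exists u.
by rewrite Et mulrC divfK.
Qed.

End CyclicShape.

(** * Roots of a p-polynomial as a subspace *)

Section LinearShape.
Variables (p n : nat) (F : finFieldType) (K : closedFieldType).
Variable (iota : {rmorphism F -> K}).
Hypotheses (p_prime : prime p) (card_F : #|F| = (p ^ n.+1)%N).

Let pK : p \in [pchar K] := pchar_closure iota p_prime card_F.

Lemma exprD_pexp i (R : comNzRingType) (x y : R) : p \in [pchar R] ->
  (x + y) ^+ (p ^ i) = x ^+ (p ^ i) + y ^+ (p ^ i).
Proof.
move=> pR; apply: exprDn_pchar; rewrite pnatX; apply/orP; left.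
by rewrite pnatE.
Qed.

Lemma frob_range y : y ^+ #|F| = y -> exists x, y = iota x.
Proof.
move=> yq; have : map_poly iota ('X^#|F| - 'X) = \prod_x ('X - (iota x)%:P).
  rewrite finField_genPoly rmorph_prod; apply: eq_bigr => x _.
  by rewrite rmorphB /= map_polyX map_polyC.
rewrite rmorphB /= map_polyXn map_polyX => /(congr1 (fun A : {poly K} => A.[y])).
rewrite /= !hornerE yq subrr horner_prod => /esym/eqP/prodf_eq0[x _].
by rewrite !hornerE subr_eq0 => /eqP; exists x.
Qed.

Lemma frob_iota x : iota x ^+ #|F| = iota x.
Proof. by rewrite -rmorphXn expf_card. Qed.

(** [X^(p^k) - X] is separable, its derivative being [-1], and the hypothesis places its roots in
    the image of [F]. *)
Lemma fixed_field_card k : (0 < k)%N ->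
    (forall c : K, c ^+ (p ^ k) = c -> c ^+ #|F| = c) ->
  #|[set c : F | c ^+ (p ^ k) == c]| = (p ^ k)%N.
Proof.
move=> k_gt0 fixF; set A := [set _ | _].
have pk_gt1 : (1 < p ^ k)%N.
  by rewrite -{1}(expn0 p) ltn_exp2l // prime_gt1.
pose P : {poly K} := 'X^(p ^ k) - 'X.
have sP : size P = (p ^ k).+1.
  by rewrite size_polyDl ?size_polyXn // size_polyN size_polyX ltnS.
have Pmon : lead_coef P = 1.
  by rewrite lead_coefDl ?lead_coefXn // size_polyN size_polyX size_polyXn ltnS.
have [rs EP] := closed_field_poly_normal P; rewrite Pmon scale1r in EP.
have sep : coprimep P P^`().
  have -> : P^`() = -1 *: 1%:P.
    rewrite /P derivB derivX derivXn -(prednK k_gt0) expnS mulrnA.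
    by rewrite (mulrn_pchar (pchar_polyC pK)) mul0rn sub0r scaleN1r.
  by rewrite coprimepZr ?coprimep1 // oppr_eq0 oner_eq0.
have Urs : uniq rs by rewrite -separable_prod_XsubC -EP unlock.
have srs : size rs = (p ^ k)%N by have := sP; rewrite EP size_prod_XsubC => -[].
have rsE c : (c \in rs) = (c ^+ (p ^ k) == c).
  by rewrite -root_prod_XsubC -EP rootE !hornerE subr_eq0.
apply/eqP; rewrite eqn_leq; apply/andP; split.
  rewrite -srs cardE -(size_map iota); apply: uniq_leq_size.
    by rewrite map_inj_uniq ?enum_uniq //; exact: fmorph_inj.
  move=> _ /mapP[c cA ->]; move: cA; rewrite mem_enum inE rsE -rmorphXn => /eqP->.
  exact: eqxx.
rewrite -srs cardE -(size_map iota); apply: uniq_leq_size Urs _ => c crs.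
have /eqP cc : c ^+ (p ^ k) == c by rewrite -rsE.
have [x Ex] := frob_range (fixF c cc); rewrite Ex map_f // mem_enum inE.
by rewrite -(inj_eq (fmorph_inj iota)) rmorphXn -Ex cc.
Qed.

Lemma fixed_subfield k : is_subfield [set c : F | c ^+ (p ^ k) == c].
Proof.
have pF : p \in [pchar F] by exact: card_finPcharP card_F p_prime.
split=> [|x y|x y]; rewrite !inE ?expr1n //.
  move=> /eqP Ex /eqP Ey; have := @exprD_pexp k F (x - y) y pF.
  by rewrite subrK Ex Ey => /eqP; rewrite eq_sym -subr_eq opprK.
by move=> /eqP Ex /eqP Ey; rewrite exprMn exprVn Ex Ey.
Qed.

Variables (S : {set F}) (v : nat).
Hypotheses (v_gt0 : (0 < v)%N) (S0 : 0 \in S) (card_S : (2 < #|S|)%N).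
Let T : {poly K} := \prod_(e in S :\ 0) ('X - (iota e)%:P).
Hypothesis T_exp : forall j, T`_j != 0 -> exists i, (1 + v * j = p ^ i)%N.

Let r := #|S :\ 0|.
Let r_gt0 : (0 < r)%N.
Proof. by move: card_S; rewrite (cardsD1 0%R S) S0 add1n ltnS; exact: ltnW. Qed.

Let vr_exp : exists i, (1 + v * r = p ^ i)%N.
Proof.
apply: T_exp.
have <- : (size T).-1 = r by rewrite /T -big_enum size_prod_XsubC -cardE.
rewrite -lead_coefE (monicP _) ?oner_eq0 //; exact: monic_prod_XsubC.
Qed.

(** [k] is the order of [p] modulo [v], finite because [1 + v * r] is a power of [p]. Each exponent
    [i] in [T_exp] is a multiple of [k], whence linearity over the field of order [p ^ k]. *)
Let order_of_p : exists2 k, (0 < k)%N /\ (v %| p ^ k - 1)%N &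
  forall i, (v %| p ^ i - 1)%N -> (k %| i)%N.
Proof.
have [i0 Ei0] := vr_exp.
have ex : exists k, (0 < k)%N && (v %| p ^ k - 1)%N.
  exists i0; rewrite -Ei0 addKn dvdn_mulr // andbT lt0n; apply: contraTneq r_gt0 => i00.
  by move: Ei0; rewrite i00 expn0 -[RHS]addn0 => /addnI/eqP;
     rewrite muln_eq0 gtn_eqF // => /eqP->.
have [k /andP[k_gt0 vk] kmin] := ex_minnP ex; exists k => // i vi.
have pmod m : (v %| p ^ m - 1)%N = (p ^ m == 1 %[mod v]).
  by rewrite eqn_mod_dvd // expn_gt0 prime_gt0.
have : (v %| p ^ (i %% k) - 1)%N.
  have Ei : (p ^ i = p ^ (i %% k) %[mod v])%N.
    move: vk; rewrite pmod => /eqP vk.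
    rewrite {1}(divn_eq i k) expnD (mulnC (i %/ k)%N) expnM -modnMml -modnXm vk.
    by rewrite modnXm exp1n modnMml mul1n.
  by move: vi; rewrite !pmod Ei.
have [/eqP //|ik_gt0 vik] := posnP (i %% k).
by have := kmin (i %% k)%N; rewrite ik_gt0 vik leqNgt ltn_mod k_gt0 => /(_ isT).
Qed.

Lemma linear_shape : power_subspace p S.
Proof.
have [k [k_gt0 v_dvd] kP] := order_of_p.
have [s1 /setD1P[nzs1 Ss1]] : exists s, s \in S :\ 0 by apply/card_gt0P.
have nzi1 : iota s1 != 0 by rewrite fmorph_eq0.
pose FF (c : K) := c ^+ (p ^ k) == c.
(* Dividing by [s1] puts [1] in the space. When [w1 ^+ v = iota s1], this is the root space of
   [X * T(X^v)] scaled by [w1^-1]; so far it lies only in [K]. *)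
pose inU (u : K) := exists2 e, e \in S & u ^+ v * iota s1 = iota e.
have [w1 Ew1] : exists w, w ^+ v = iota s1.
  have [|y /rootP] := closed_rootP ('X^v - (iota s1)%:P) _.
    by rewrite size_XnsubC // eqSS -lt0n.
  by rewrite !hornerE => /eqP; rewrite subr_eq0 => /eqP; exists y.
have nzw1 : w1 != 0.
  by apply: contraNneq nzi1 => w0; rewrite -Ew1 w0 expr0n gtn_eqF.
pose LL (x : K) := \sum_(j < size T) T`_j * x ^+ (1 + v * j).
have LLE x : LL x = x * T.[x ^+ v].
  rewrite horner_coef mulr_sumr; apply: eq_bigr => j _.
  by rewrite exprD expr1 exprM mulrCA.
have inUP u : inU u <-> LL (w1 * u) = 0.
  rewrite LLE exprMn Ew1; split=> [[e Se Eu]|].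
    have [e0|nze] := eqVneq e 0.
      move/eqP: Eu; rewrite e0 rmorph0 mulf_eq0 (negPf nzi1) orbF expf_eq0 v_gt0 /=.
      by move/eqP->; rewrite mulr0 mul0r.
    rewrite [iota s1 * _]mulrC Eu /T (big_setD1 e) ?inE ?nze //=.
    by rewrite hornerM hornerXsubC subrr mul0r mulr0.
  move/eqP; rewrite mulf_eq0 mulf_eq0 (negPf nzw1) /= => /orP[/eqP->|].
    by exists 0; rewrite // rmorph0 expr0n gtn_eqF // mul0r.
  rewrite horner_prod => /prodf_eq0[e /setD1P[_ Se]].
  by rewrite !hornerE subr_eq0 mulrC => /eqP; exists e.
have LLD x y : LL (x + y) = LL x + LL y.
  rewrite -big_split; apply: eq_bigr => j _ /=.
  have [->|nzT] := eqVneq T`_j 0; first by rewrite !mul0r addr0.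
  by have [i ->] := T_exp nzT; rewrite (exprD_pexp _ _ _ pK) mulrDr.
have LLZ c x : FF c -> LL (c * x) = c * LL x.
  move=> /eqP FFc; rewrite mulr_sumr; apply: eq_bigr => j _ /=.
  have [->|nzT] := eqVneq T`_j 0; first by rewrite !mul0r mulr0.
  have [i Ei] := T_exp nzT; have /dvdnP[m Em] : (k %| i)%N.
    by apply: kP; rewrite -Ei addKn dvdn_mulr.
  have -> : (c * x) ^+ (1 + v * j) = c * x ^+ (1 + v * j).
    rewrite exprMn; congr (_ * _); rewrite Ei Em mulnC expnM.
    by elim: m {Em Ei} => [|m IHm]; rewrite ?expn0 ?expr1 // expnS exprM FFc.
  by rewrite mulrCA.
have UD x y : inU x -> inU y -> inU (x + y).
  by move=> /inUP Ux /inUP Uy; apply/inUP; rewrite mulrDr LLD Ux Uy addr0.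
have UZ c x : FF c -> inU x -> inU (c * x).
  by move=> Fc /inUP Ux; apply/inUP; rewrite mulrCA LLZ // Ux mulr0.
have U1 : inU 1 by exists s1; rewrite // expr1n mul1r.
have FFD x y : FF x -> FF y -> FF (x + y).
  by move=> /eqP Fx /eqP Fy; rewrite /FF (exprD_pexp _ _ _ pK) Fx Fy.
have FFM x y : FF x -> FF y -> FF (x * y).
  by move=> /eqP Fx /eqP Fy; rewrite /FF exprMn Fx Fy.
have FFV x : FF x -> FF x^-1 by move=> /eqP Fx; rewrite /FF exprVn Fx.
have FFN x : FF x -> FF (- x).
  move=> /eqP Fx; rewrite /FF; have := exprD_pexp k x (- x) pK.
  rewrite subrr expr0n gtn_eqF ?expn_gt0 ?prime_gt0 // Fx => /esym/eqP.
  by rewrite addrC addr_eq0.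
have U_root e : e \in S -> exists2 u, inU u & u ^+ v * iota s1 = iota e.
  move=> Se; have [|y /rootP] := closed_rootP ('X^v - (iota e / iota s1)%:P) _.
    by rewrite size_XnsubC // eqSS -lt0n.
  rewrite !hornerE => /eqP; rewrite subr_eq0 => /eqP Ey.
  by exists y; [exists e | ]; rewrite // Ey divfK.
pose t := ((p ^ k - 1) %/ v)%N; have Et : (t * v = p ^ k - 1)%N by rewrite divnK.
(* If [u ^+ v = e / s1], then [(e / s1) ^+ t = u ^+ (p ^ k - 1)], so the test is whether the space
   lies in the field of order [p ^ k]. In that case counting shows that the nonzero values are a
   coset of the [t]-th roots of unity. *)
have [/forall_inP small|] := boolP [forall e in S :\ 0, (e / s1) ^+ t == 1].
  have t_gt0 : (0 < t)%N.
    rewrite divn_gt0 // dvdn_leq // subn_gt0 -{1}(expn0 p) ltn_exp2l // prime_gt1 //.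
  have le_rt : (r <= t)%N.
    rewrite /r cardE -(size_map (fun e => e / s1)); apply: max_unity_roots => //.
      by apply/allP => _ /mapP[e Se ->]; rewrite unity_rootE; apply: small; rewrite -mem_enum.
    by rewrite map_inj_uniq ?enum_uniq // => x y /(mulIf (invr_neq0 nzs1)).
  have le_tr : (t <= r)%N.
    have [i0 Ei0] := vr_exp; have k_i0 : (k %| i0)%N by apply: kP; rewrite -Ei0 addKn dvdn_mulr.
    have i0_gt0 : (0 < i0)%N.
      rewrite lt0n; apply: contraTneq r_gt0 => i00; move: Ei0.
      by rewrite i00 expn0 -[RHS]addn0 => /addnI/eqP;
     rewrite muln_eq0 gtn_eqF // => /eqP->.
    rewrite -(@leq_pmul2l v) // mulnC Et leq_subLR Ei0 leq_exp2l ?prime_gt1 //.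
    exact: dvdn_leq.
  have Er : #|S :\ 0| = t by apply/eqP; rewrite eqn_leq le_rt.
  apply: (cyclic_shape card_F t_gt0 S0 Ss1 nzs1 Er) => s Ss nzs.
  by apply/eqP/small; rewrite !inE nzs.
rewrite negb_forall_in => /exists_inP[e0 /setD1P[nze0 Se0] ne0].
have [u Uu Eu] := U_root e0 Se0.
have nFu : ~~ FF u.
  apply: contra ne0 => /eqP Fu; rewrite -(inj_eq (fmorph_inj iota)) rmorphXn rmorph1 fmorph_div.
  have nzu : u != 0.
    apply: contraNneq nze0 => u0; move/eqP: Eu; rewrite u0 expr0n gtn_eqF // mul0r eq_sym.
    by rewrite fmorph_eq0.
  rewrite -Eu mulfK // -exprM mulnC Et; apply/eqP/(mulfI nzu).
  by rewrite mulr1 -exprS subn1 prednK // expn_gt0 prime_gt0.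
pose fr (x : K) := x ^+ #|F|.
have frD x y : fr (x + y) = fr x + fr y by rewrite /fr card_F (exprD_pexp _ _ _ pK).
(* Frobenius fixes [x ^+ v], so it multiplies [x] by a [v]-th root of unity, which is in [FF]
   because [v] divides [p ^ k - 1]. *)
have frU x : inU x -> exists2 z, FF z & fr x = z * x.
  move=> [e Se Ex]; have [->|nzx] := eqVneq x 0.
    exists 1; first by rewrite /FF expr1n.
    by rewrite /fr mulr0 expr0n gtn_eqF // card_F expn_gt0 prime_gt0.
  exists (fr x / x); last by rewrite divfK.
  have zv : (fr x / x) ^+ v = 1.
    have xv : x ^+ v = iota (e / s1) by rewrite fmorph_div -Ex mulfK.
    by rewrite expr_div_n /fr exprAC xv frob_iota divff // -xv expf_neq0.
  rewrite /FF -(subnK (_ : 1 <= p ^ k)%N) ?expn_gt0 ?prime_gt0 // exprD expr1 -Et mulnC exprM zv.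
  by rewrite expr1n mul1r.
have FF_U c : FF c -> inU c by move=> Fc; rewrite -[c]mulr1; apply: UZ.
have FF_fr c : FF c -> FF (fr c) by move=> /eqP Fc; rewrite /FF /fr exprAC Fc.
have FF1 : FF 1 by rewrite /FF expr1n.
(* Comparing the conjugates of [x] and [x + c] puts [(z0 - zc) * x] in [FF]. As [x] is not in [FF],
   [z0 = zc] and [fr c = z0 * c]; taking [c = 1] gives [z0 = 1]. *)
have fr_fix x : inU x -> ~~ FF x -> fr x = x /\ forall c, FF c -> fr c = c.
  move=> Ux nFx; have [z0 Fz0 Ez0] := frU x Ux.
  have fr_FF c : FF c -> fr c = z0 * c.
    move=> Fc; have [zc Fzc Ezc] := frU (x + c) (UD _ _ Ux (FF_U c Fc)).
    have Ed : (z0 - zc) * x = zc * c - fr c.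
      by move: Ezc; rewrite frD Ez0 => /(canRL (addrK _)) e; rewrite mulrBl e; ring.
    have z0c : z0 = zc.
      apply/eqP; rewrite -subr_eq0; apply: contraNT nFx => nz.
      rewrite -[x](mulKf nz) Ed; apply: (FFM); first by apply/FFV/FFD => //; exact: FFN.
      by apply: (FFD); [exact: FFM | exact/FFN/FF_fr].
    by move/eqP: Ed; rewrite z0c subrr mul0r eq_sym subr_eq0 => /eqP.
  have z01 : z0 = 1 by have := fr_FF 1 FF1; rewrite /fr expr1n mulr1.
  by split=> [|c /fr_FF]; rewrite ?Ez0 z01 mul1r.
have fixU x : inU x -> exists y, x = iota y.
  move=> Ux; apply: frob_range; have [Fx|nFx] := boolP (FF x).
    exact: (fr_fix u Uu nFu).2.
  exact: (fr_fix x Ux nFx).1.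
have fixFF (c : K) : c ^+ (p ^ k) = c -> c ^+ #|F| = c.
  by move=> Fc; apply: ((fr_fix u Uu nFu).2 c); apply/eqP. 
pose U := [set x : F | x ^+ v * s1 \in S].
have UP x : x \in U <-> inU (iota x).
  rewrite inE; split=> [h|[e Se /eqP]].
    by exists (x ^+ v * s1); rewrite // rmorphM rmorphXn.
  by rewrite -rmorphXn -rmorphM (inj_eq (fmorph_inj iota)) => /eqP->.
apply: (@power_subspaceP p F S s1 0 U v k) => //.
- exists [set c : F | c ^+ (p ^ k) == c]; split; first exact: fixed_subfield.
    exact: fixed_field_card.
  split=> [|x y /UP Ux /UP Uy|c x Fc /UP Ux].
  + by rewrite inE expr0n gtn_eqF // mul0r.
  + by apply/UP; rewrite rmorphD; exact: UD.
  apply/UP; rewrite rmorphM; apply: UZ => //.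
  by move: Fc; rewrite inE /FF -rmorphXn (inj_eq (fmorph_inj iota)).
- by rewrite inE expr1n mul1r.
move=> s; split=> [Ss|[x]]; last by rewrite inE addr0 mulrC => Ux ->.
have [x Ux Ex] := U_root s Ss; have [y Ey] := fixU x Ux.
exists y; first by apply/UP; rewrite -Ey.
rewrite addr0 mulrC; apply: (fmorph_inj iota); rewrite -Ex Ey rmorphM rmorphXn.
by [].
Qed.

End LinearShape.

(** * Polynomials from subspaces *)

Lemma leq_card_fibers (T T' : finType) (h : T -> T') (A : {set T}) m :
  (forall y, #|[set x in A | h x == y]| <= m)%N -> (#|A| <= #|h @: A| * m)%N.
Proof.
move=> le_m; rewrite -sum1_card (partition_big_imset h) -sum_nat_const.
apply: leq_sum => y _; rewrite sum1_card; apply: leq_trans (le_m y).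
by rewrite cardsE.
Qed.

Lemma geq_card_fibers (T T' : finType) (h : T -> T') (A : {set T}) m :
  (forall x, x \in A -> m <= #|[set x' in A | h x' == h x]|)%N -> (#|h @: A| * m <= #|A|)%N.
Proof.
move=> ge_m; rewrite -[leqRHS]sum1_card (partition_big_imset h) -sum_nat_const.
apply: leq_sum => _ /imsetP[x Ax ->]; rewrite sum1_card; apply: leq_trans (ge_m x Ax) _.
by rewrite cardsE.
Qed.

(** * Roots of unity in a subfield *)

Section Subfield.
Variables (F : finFieldType) (k : {set F}).
Hypothesis k_field : is_subfield k.

Let k1 : 1 \in k. Proof. by case: k_field. Qed.
Let kB x y : x \in k -> y \in k -> x - y \in k. Proof. by case: k_field => _ h _; exact: h. Qed.
Let kV x y : x \in k -> y \in k -> x / y \in k. Proof. by case: k_field => _ _; exact. Qed.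
Let k0 : 0 \in k. Proof. by rewrite -(subrr 1) kB. Qed.
Let kN1 : -1 \in k. Proof. by rewrite -sub0r kB. Qed.
Let kM x y : x \in k -> y \in k -> x * y \in k.
Proof. by move=> kx ky; rewrite -[y]invrK kV // -[_^-1]mul1r kV. Qed.

Lemma subfield_opp1 : -1 \in k. Proof. exact: kN1. Qed.

(** Multiplication by [x] permutes the nonzero elements of [k]; their product is compared before and
    after. *)
Lemma subfield_expr_card x : x \in k -> x != 0 -> x ^+ (#|k| - 1) = 1.
Proof.
move=> kx nzx; have nzP : \prod_(y in k :\ 0) y != 0.
  by apply/prodf_neq0 => y /setD1P[].
apply: (mulIf nzP); rewrite mul1r.
have -> : (#|k| - 1)%N = #|k :\ 0| by rewrite (cardsD1 0%R k) k0 add1n subn1.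
rewrite -prodr_const -big_split /= [RHS](reindex_inj (mulfI nzx)) /=.
apply: eq_bigl => y; rewrite !inE mulf_eq0 (negPf nzx) /=; congr (_ && _).
apply/idP/idP => [ky|kxy]; first exact: kM.
by rewrite -[y](mulKf nzx) mulrC kV.
Qed.

Lemma subfield_unity_roots v : (0 < v)%N -> (v %| #|k| - 1)%N ->
  exists2 rs : seq F, uniq rs /\ size rs = v & forall z, z \in rs -> z \in k /\ z ^+ v = 1.
Proof.
move=> v_gt0 /dvdnP[t Et].
have m_gt0 : (0 < #|k| - 1)%N.
  by rewrite subn_gt0 (cardsD1 0%R k) k0 (cardsD1 1%R) !inE oner_eq0 k1.
have /hasP[z] : has (#|k| - 1).-primitive_root (enum (k :\ 0)).
  apply: has_prim_root => //; rewrite ?enum_uniq //.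
    apply/allP => x; rewrite mem_enum unity_rootE => /setD1P[nzx kx].
    by rewrite subfield_expr_card.
  by rewrite -cardE (cardsD1 0%R k) k0 add1n subn1.
rewrite mem_enum => /setD1P[nzz kz] prim_z.
have prim_y : v.-primitive_root (z ^+ t).
  have -> : t = ((#|k| - 1) %/ v)%N by rewrite Et mulnK.
  by apply: (dvdn_prim_root prim_z); rewrite Et dvdn_mull.
have kX y i : y \in k -> y ^+ i \in k.
  by move=> ky; elim: i => [|i IHi]; rewrite ?expr0 // exprS kM.
exists [seq (z ^+ t) ^+ (nat_of_ord i) | i <- enum 'I_v]; first split.
- rewrite map_inj_uniq ?enum_uniq // => i j /eqP.
  rewrite (eq_prim_root_expr prim_y) !modn_small ?ltn_ord // => /eqP; exact: val_inj.
- by rewrite size_map size_enum_ord.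
move=> _ /mapP[i _ ->]; split; first by rewrite !kX.
by rewrite (exprAC (z ^+ t)) (prim_expr_order prim_y) expr1n.
Qed.

End Subfield.

(** * Subspace polynomials and the minimality of their powers *)

Section Converse.
Variables (p n : nat) (F : finFieldType) (K : closedFieldType).
Variable (iota : {rmorphism F -> K}).
Hypotheses (p_prime : prime p) (card_F : #|F| = (p ^ n.+1)%N).
Let pK : p \in [pchar K] := pchar_closure iota p_prime card_F.

Variables (U : {set F}).
Hypotheses (U0 : 0 \in U) (UB : forall x y, x \in U -> y \in U -> x - y \in U).

Let UN x : x \in U -> - x \in U. Proof. by move=> Ux; rewrite -sub0r UB. Qed.
Let UD x y : x \in U -> y \in U -> x + y \in U.
Proof. by move=> Ux Uy; rewrite -[y]opprK UB ?UN. Qed.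
Let UDr x y : x \in U -> (x + y \in U) = (y \in U).
Proof.
move=> Ux; apply/idP/idP => [|Uy]; last exact: UD.
by move/UB/(_ Ux); rewrite addrC addKr.
Qed.

Let MU (x : K) := \prod_(u in U) (x - iota u).
Let MF (x : F) := \prod_(u in U) (x - u).

Lemma MU_iota x : MU (iota x) = iota (MF x).
Proof. by rewrite rmorph_prod; apply: eq_bigr => u _; rewrite rmorphB. Qed.

Lemma MU_shift u y : u \in U -> MU (iota u + y) = MU y.
Proof.
move=> Uu; rewrite /MU (reindex_inj (addrI u)) /=; apply: eq_big => [w|w _].
  by rewrite UDr.
by rewrite rmorphD; ring.
Qed.

Let PU := \prod_(u in U) ('X - (iota u)%:P).
Let PUE x : PU.[x] = MU x.
Proof. by rewrite horner_prod; apply: eq_bigr => u _; rewrite !hornerE. Qed.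
Let size_PU : size PU = #|U|.+1.
Proof. by rewrite /PU -big_enum size_prod_XsubC -cardE. Qed.
Let U_gt0 : (0 < #|U|)%N. Proof. by apply/card_gt0P; exists 0. Qed.

Lemma MU_root u : u \in U -> MU (iota u) = 0.
Proof. by move=> Uu; rewrite /MU (bigD1 u) //= subrr mul0r. Qed.

(** In [Q] the leading terms cancel, so its degree is less than [#|U|], while translation invariance
    makes it vanish on [U]. *)
Lemma MUD x y : MU (x + y) = MU x + MU y.
Proof.
pose Q := PU \Po ('X + y%:P) - PU - (MU y)%:P.
suff Q0 : Q = 0.
  have := congr1 (fun A : {poly K} => A.[x]) Q0; rewrite /= /Q !hornerE horner_comp !hornerE !PUE.
  by rewrite -addrA -opprD => /eqP; rewrite subr_eq0 => /eqP.
apply/eqP; apply: contraT => nzQ.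
have PU_mon : PU \is monic by exact: monic_prod_XsubC.
have sQ : (size Q <= #|U|)%N.
  apply: leq_trans (size_polyD _ _) _; rewrite geq_max size_polyN.
  rewrite (leq_trans (size_polyC_leq1 _)) // andbT.
  have sX : size ('X + y%:P) = 2%N by rewrite size_XaddC.
  have sc : size (PU \Po ('X + y%:P)) = size PU by rewrite size_comp_poly2.
  have lc : lead_coef (PU \Po ('X + y%:P)) = 1.
    by rewrite lead_coef_comp ?sX // lead_coefXaddC expr1n mulr1 (monicP PU_mon).
  apply/leq_sizeP => j; rewrite leq_eqVlt coefB => /orP[/eqP<-|lt].
    have := lc; have := monicP PU_mon; rewrite !lead_coefE sc size_PU /= => -> ->.
    exact: subrr.
  by rewrite !nth_default ?subrr // ?sc size_PU.
have := max_poly_roots nzQ (rs := [seq iota u | u in U]).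
rewrite map_inj_uniq ?enum_uniq; last exact: fmorph_inj.
rewrite size_map -cardE => /(_ _ isT) lt.
suff: (#|U| < #|U|)%N by rewrite ltnn.
apply: leq_trans (lt _) sQ.
apply/allP => _ /imageP[u Uu ->]; apply/rootP.
by rewrite /Q !hornerE horner_comp !hornerE !PUE MU_shift // MU_root // subr0 subrr.
Qed.

Lemma MFD x y : MF (x + y) = MF x + MF y.
Proof. by apply: (fmorph_inj iota); rewrite rmorphD -!MU_iota rmorphD MUD. Qed.

Lemma MF_eq0 x : (MF x == 0) = (x \in U).
Proof.
apply/idP/idP => [/prodf_eq0[u Uu]|Ux].
  by rewrite subr_eq0 => /eqP->.
by rewrite -(fmorph_eq0 iota) -MU_iota MU_root.
Qed.

Lemma MF_fiber x u : (MF (x + u) == MF x) = (u \in U).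
Proof. by rewrite MFD -subr_eq0 addrC addKr MF_eq0. Qed.

Let W := [set MF x | x : F].

(** The fibres of [MF] are the cosets of [U], and additivity turns [MU x - MU (iota x0)] into
    [MU (x - iota x0)], the product over the coset of [x0]. *)
Lemma prod_MU (x : K) : \prod_(w in W) (MU x - iota w) = x ^+ #|F| - x.
Proof.
have -> : x ^+ #|F| - x = \prod_(y in F) (x - iota y).
  have : map_poly iota ('X^#|F| - 'X) = \prod_y ('X - (iota y)%:P).
    rewrite finField_genPoly rmorph_prod; apply: eq_bigr => y _.
    by rewrite rmorphB /= map_polyX map_polyC.
  rewrite rmorphB /= map_polyXn map_polyX => /(congr1 (fun A : {poly K} => A.[x])).
  rewrite /= !hornerE horner_prod => ->; apply: eq_big => // y _.
  by rewrite !hornerE.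
rewrite [RHS](partition_big_imset MF) /=; apply: eq_big => [w|w].
  by apply/imsetP/imsetP => -[y _ ->]; exists y.
case/imsetP => x0 _ ->; rewrite [RHS](reindex_inj (addrI x0)) /=.
rewrite -MU_iota; have -> : MU x - MU (iota x0) = MU (x - iota x0).
  by have := MUD (x - iota x0) (iota x0); rewrite subrK => ->; rewrite addrK.
by apply: eq_big => [u|u _]; rewrite ?MF_fiber // rmorphD opprD addrA.
Qed.

Lemma card_W : (#|W| * #|U| <= #|F|)%N.
Proof.
have -> : W = MF @: [set: F] by apply/setP => w; apply/imsetP/imsetP => -[y _ ->]; exists y.
rewrite -[leqRHS]cardsT; apply: geq_card_fibers => x _.
rewrite -(card_imset (mem U) (addrI x)); apply: subset_leq_card.
by apply/subsetP => _ /imsetP[u Uu ->]; rewrite !inE MF_fiber.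
Qed.

Let PW : {poly F} := \prod_(w in W) ('X - w%:P).
Let size_PW : size PW = #|W|.+1.
Proof. by rewrite /PW -big_enum size_prod_XsubC -cardE. Qed.
Let W_gt0 : (0 < #|W|)%N. Proof. by apply/card_gt0P; exists (MF 0); apply: imset_f. Qed.

Lemma card_value_set (h : {poly F}) (A : {set F}) : (1 < size h)%N ->
  (#|A| <= #|[set h.[x] | x in A]| * (size h).-1)%N.
Proof.
move=> h_gt1; apply: leq_card_fibers => y.
have nz : h - y%:P != 0.
  rewrite -size_poly_gt0 size_polyDl ?size_polyN ?(leq_ltn_trans (size_polyC_leq1 _)) //.
  exact: ltnW.
have := max_poly_roots nz (rs := enum [set x in A | h.[x] == y]).
rewrite -cardE enum_uniq size_polyDl; last first.
  by rewrite size_polyN (leq_ltn_trans (size_polyC_leq1 _)).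
move=> lt; rewrite -ltnS prednK ?(ltnW h_gt1) //; apply: lt => //.
apply/allP => x; rewrite mem_enum !inE => /andP[_ /eqP <-].
by rewrite rootE !hornerE subrr.
Qed.

(** Choose [z] in [K] with [MU z = iota x]. By [prod_MU] the value is [z ^+ #|F| - z], which [MU]
    sends to [x ^+ #|F| - x = 0], and the zeros of [MF] are the elements of [U]. *)
Lemma PW_value x : PW.[x] \in U.
Proof.
have [|z /rootP] := closed_rootP (PU - (iota x)%:P) _.
  rewrite size_polyDl size_PU ?eqSS -?lt0n // size_polyN.
  by rewrite (leq_ltn_trans (size_polyC_leq1 _)).
rewrite !hornerE PUE => /eqP; rewrite subr_eq0 => /eqP Ez.
have E : iota PW.[x] = z ^+ #|F| - z.
  rewrite -prod_MU Ez horner_prod rmorph_prod; apply: eq_bigr => w _.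
  by rewrite !hornerE rmorphB.
rewrite -MF_eq0 -(fmorph_eq0 iota) -MU_iota E.
have -> : MU (z ^+ #|F| - z) = MU (z ^+ #|F|) - MU z.
  by have := MUD (z ^+ #|F| - z) z; rewrite subrK => ->; rewrite addrK.
have -> : MU (z ^+ #|F|) = MU z ^+ #|F|.
  rewrite /MU -prodrXl; apply: eq_bigr => u _.
  rewrite -{1}(frob_iota iota u); apply/eqP; rewrite subr_eq; apply/eqP.
  by rewrite card_F -(exprD_pexp p_prime _ _ _ pK) subrK.
by rewrite Ez frob_iota subrr.
Qed.

(** A polynomial of degree [#|W|] takes at least [#|F| / #|W|] values, and this is at least [#|U|]
    by [card_W]. *)
Lemma PW_image : [set PW.[x] | x in [set: F]] = U.
Proof.
apply/eqP; rewrite eqEcard; apply/andP; split.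
  by apply/subsetP => _ /imsetP[x _ ->]; exact: PW_value.
rewrite -(@leq_pmul2l #|W|) // (leq_trans card_W) // mulnC -cardsT.
by have := card_value_set [set: F] (_ : 1 < size PW)%N; rewrite size_PW /=; apply.
Qed.

(** Fibres of [f] have at most [deg f] points, which gives [lo]. Each nonzero [v]-th power from [U]
    has at least [v] roots in [U], since [U] is stable under the [v]-th roots of unity of [k]; this
    gives [hi]. The two bounds determine the quotient. *)
Lemma mvsp_of_subspace k v (a b : F) : is_subfield k -> is_subspace_over k U ->
    (0 < v)%N -> (v %| #|k| - 1)%N -> a != 0 ->
  exists f : {poly F}, is_mvsp f /\ value_set f = affine_image a b (power_set_image U v).
Proof.
move=> k_field [_ _ UZ] v_gt0 v_dvd nza.
pose f := a *: PW ^+ v + b%:P; exists f.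
have nzPW : PW != 0 by rewrite -size_poly_gt0 size_PW.
have sPv : size (a *: PW ^+ v) = (v * #|W|).+1.
  rewrite size_scale // -(prednK (_ : 0 < size (PW ^+ v))%N).
    by rewrite degX size_PW mulnC.
  by rewrite size_poly_gt0 expf_neq0.
have vW_gt0 : (0 < v * #|W|)%N by rewrite muln_gt0 v_gt0.
have sf : size f = (v * #|W|).+1.
  by rewrite size_polyDl sPv // (leq_ltn_trans (size_polyC_leq1 _)).
have Ef : value_set f = affine_image a b (power_set_image U v).
  apply/setP => y; apply/imsetP/imsetP => [[x _ ->]|[_ /imsetP[u Uu ->] ->]].
    by exists (PW.[x] ^+ v); rewrite ?hornerE //; apply: imset_f; exact: PW_value.
  by move: Uu; rewrite -PW_image => /imsetP[x _ ->]; exists x; rewrite // !hornerE.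
split=> //; split; first by rewrite sf ltnS.
rewrite Ef /affine_image card_imset; last by move=> x y /addIr/(mulfI nza).
rewrite sf /=; set Y := power_set_image U v.
have lo : (#|F| <= #|Y| * (v * #|W|))%N.
  have := card_value_set [set: F] (_ : 1 < size f)%N; rewrite sf cardsT => /(_ vW_gt0).
  have -> : [set f.[x] | x in [set: F]] = value_set f.
    by apply/setP => w; apply/imsetP/imsetP => -[y _ ->]; exists y.
  by rewrite Ef /affine_image card_imset //; move=> x y /addIr/(mulfI nza).
have Y0 : 0 \in Y by apply/imsetP; exists 0; rewrite // expr0n gtn_eqF.
have hi : ((#|Y| - 1) * (v * #|W|) <= #|F| - 1)%N.
  have : (#|[set u ^+ v | u in U :\ 0%R]| * v <= #|U :\ 0%R|)%N.
    apply: geq_card_fibers => u /setD1P[nzu Uu].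
    have [rs [Urs srs] rsP] := subfield_unity_roots k_field v_gt0 v_dvd.
    rewrite -{1}srs -(size_map ( *%R^~ u)) cardE; apply: uniq_leq_size.
      by rewrite map_inj_uniq //; exact: mulIf.
    move=> _ /mapP[z /rsP[kz z1] ->]; rewrite mem_enum !inE /= exprMn z1 mul1r eqxx andbT.
    rewrite mulf_eq0 (negPf nzu) orbF UZ // andbT.
    by apply: contra_eq_neq z1 => ->; rewrite expr0n gtn_eqF // eq_sym oner_eq0.
  have -> : [set u ^+ v | u in U :\ 0] = Y :\ 0.
    apply/setP => y; apply/imsetP/setD1P => [[u /setD1P[nzu Uu] ->]|[nzy /imsetP[u Uu Ey]]].
      by rewrite expf_neq0 //; split=> //; apply: imset_f.
    exists u => //; rewrite !inE Uu andbT.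
    by apply: contraNneq nzy => u0; rewrite Ey u0 expr0n gtn_eqF.
  have -> : #|Y :\ 0| = (#|Y| - 1)%N by rewrite (cardsD1 0%R Y) Y0 add1n subn1.
  have -> : #|U :\ 0| = (#|U| - 1)%N by rewrite (cardsD1 0%R U) U0 add1n subn1.
  rewrite mulnA => le; apply: (@leq_trans ((#|U| - 1) * #|W|)%N).
    by rewrite leq_mul2r le orbT.
  by rewrite mulnBl mul1n leq_sub // mulnC card_W.
have q_gt0 : (0 < #|F|)%N by apply/card_gt0P; exists 0.
have Y_gt0 : (0 < #|Y|)%N by apply/card_gt0P; exists 0.
apply/eqP; rewrite -[X in X == _](subnK Y_gt0) eqn_add2r eqn_leq; apply/andP; split.
  by rewrite leq_divRL.
have Y1 : (#|Y| - 1).+1 = #|Y| by rewrite subn1 prednK.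
by rewrite -ltnS Y1 ltn_divLR // subn1 prednK.
Qed.

End Converse.

(** * Translation of values and the equivalence *)

Lemma value_set_translate (F : finFieldType) (f : {poly F}) a :
  value_set (f - a%:P) = [set s - a | s in value_set f].
Proof.
apply/setP => y; apply/imsetP/imsetP => [[x _ ->]|[_ /imsetP[x _ ->] ->]].
  by exists f.[x]; rewrite ?imset_f // !hornerE.
by exists x; rewrite // !hornerE.
Qed.

Lemma mvsp_translate (F : finFieldType) (f : {poly F}) a : is_mvsp f -> is_mvsp (f - a%:P).
Proof.
case=> f_gt1 card_f; have sf : size (f - a%:P) = size f.
  by rewrite size_polyDl // size_polyN (leq_ltn_trans (size_polyC_leq1 _)).
split; rewrite sf // value_set_translate card_imset //; exact: addIr.
Qed.

Lemma degenerate_translate (F : finFieldType) (K : closedFieldType) (iota : {rmorphism F -> K})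
  (f : {poly F}) a c : degenerate iota (f - a%:P) c = degenerate iota f (c + a).
Proof.
have E : \prod_(x | (f - a%:P).[x] == c) ('X - (iota x)%:P)
       = \prod_(x | f.[x] == c + a) ('X - (iota x)%:P).
  by apply: eq_bigl => x; rewrite !hornerE subr_eq.
rewrite /degenerate E; congr (_ %| _ %/ _).
by rewrite rmorphB /= map_polyC rmorphD polyCD /= opprD addrA addrAC.
Qed.

Lemma power_subspace_of_mvsp (p n : nat) (F : finFieldType) (K : closedFieldType)
    (iota : {rmorphism F -> K}) (f : {poly F}) :
    prime p -> #|F| = (p ^ n.+1)%N -> is_mvsp f -> (2 < #|value_set f|)%N ->
  power_subspace p (value_set f).
Proof.
move=> p_prime card_F f_mvsp card_S.
(* [c] is the value moved to [0]: the degenerate one, or any value when none is degenerate, and then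
   [v = 1]. *)
have shift c : c \in value_set f ->
    degenerate iota f c \/ (forall e, e \in value_set f -> ~~ degenerate iota f e) ->
  power_subspace p (value_set f).
  move=> Sc dg; apply: (@power_subspace_translate _ _ _ c); rewrite -value_set_translate.
  have S0 : 0 \in value_set (f - c%:P).
    by rewrite value_set_translate; apply/imsetP; exists c; rewrite ?subrr.
  have mv := mvsp_translate c f_mvsp.
  have cS : (2 < #|value_set (f - c%:P)|)%N.
    by rewrite value_set_translate card_imset //; exact: addIr.
  have [v v_gt0 Hv] : exists2 v, (0 < v)%N & forall j,
      (\prod_(e in value_set (f - c%:P) :\ 0) ('X - (iota e)%:P))`_j != 0 ->
      exists i, (1 + v * j = p ^ i)%N.
    case: dg => [dgc|nd].
      apply: (exponents_degenerate p_prime card_F mv cS S0).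
      by rewrite degenerate_translate add0r.
    exists 1%N => //; apply: (exponents_nondegenerate p_prime card_F mv cS S0).
    move=> e; rewrite value_set_translate degenerate_translate => /imsetP[s Ss ->].
    by rewrite subrK; exact: nd.
  exact: (linear_shape p_prime card_F v_gt0 S0 cS Hv).
have [/exists_inP[c Sc dg]|] := boolP [exists c in value_set f, degenerate iota f c].
  by apply: (shift c) => //; left.
rewrite negb_exists_in => /forall_inP nd.
have [c Sc] : exists c, c \in value_set f by apply/card_gt0P; exact: ltn_trans card_S.
by apply: (shift c) => //; right.
Qed.

Theorem theorem2p2 (p n : nat) (F : finFieldType) (S : {set F})
    (p_prime : prime p) (n_ge1 : (1 <= n)%N) (card_F : #|F| = (p ^ n)%N)
    (card_S : (2 < #|S|)%N) :
  (exists f : {poly F}, is_mvsp f /\ value_set f = S)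
  <->
  (exists (a b : F) (U : {set F}) (v k : nat),
     [/\ a != 0,
         (1 <= k)%N /\ is_Fm_subspace (p ^ k) U /\ 1 \in U,
         (1 <= v)%N /\ (v %| p ^ k - 1)%N &
         S = affine_image a b (power_set_image U v)]).
Proof.
case: n n_ge1 card_F => // n _ card_F.
have [K [iota _]] := countable_algebraic_closure F.
split=> [[f [f_mvsp ES]]|].
  rewrite -ES in card_S *.
  exact: (power_subspace_of_mvsp iota p_prime card_F f_mvsp card_S).
case=> a [b [U [v [k [nza [k_gt0 [[k0 [k0_field k0_card Usub]] U1]] [v_gt0 v_dvd] ->]]]]].
have [U0 UD UZ] := Usub.
(* Closure under opposites is not part of the definition of a subspace; it comes from the scalar
   [-1]. *)
have UB x y : x \in U -> y \in U -> x - y \in U.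
  move=> Ux Uy; apply: UD => //; rewrite -mulN1r; apply: UZ => //.
  exact: subfield_opp1.
apply: (mvsp_of_subspace iota p_prime card_F U0 UB b k0_field Usub v_gt0) => //.
by rewrite k0_card.
Qed.
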